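(* Let $K$ be an algebraically closed valued field (with valuation of arbitrary rank), and let $I\subseteq K[x_1^{\pm1},\dots,x_n^{\pm1}]$ be an ideal. Then the following properties are equivalent for all $\gamma\in\Gamma^n$. (1) For all $f\in I$, the point $\gamma$ is a tropical root of $\operatorname{trop}(f)$. (2) The ideal $\operatorname{in}_\gamma(I)\subseteq k[x_1^{\pm1},\dots,x_n^{\pm1}]$ is proper. (3) There is $z\in(K^\times)^n$ such that $f(z)=0$ for every $f\in I$ and $v(z)=\gamma$.
   Context: $K$ has surjective valuation $v\colon K\to\Gamma\cup\{\infty\}$, where the value group $\Gamma$ is an arbitrary ordered abelian group; $k$ is the residue field, $\operatorname{res}$ the residue map, and $v(z)$ is computed coordinatewise. For $\mathbf u\in\mathbb Z^n$, $\gamma\in\Gamma^n$, write $\langle\mathbf u,\gamma\rangle=u_1\gamma_1+\dots+u_n\gamma_n$. Let $f=\sum_{\mathbf u\in S}c_{\mathbf u}x^{\mathbf u}$ be a Laurent polynomial over $K$, with $S\subseteq\mathbb Z^n$ finite and all $c_{\mathbf u}\ne0$. Its tropicalisation is $\operatorname{trop}(f)\colon\gamma\mapsto\min\{v(c_{\mathbf u})+\langle\mathbf u,\gamma\rangle\mid\mathbf u\in S\}$. A point $\gamma\in\Gamma^n$ is a tropical root of $\operatorname{trop}(f)$ if this minimum is achieved at $\gamma$ by at least two elements $\mathbf u\in S$; by convention, every $\gamma$ counts as a tropical root when $f=0$. Fix a cross-section $s\colon\Gamma\to K^\times$ of $v$ (a group homomorphism with $v(s(\gamma))=\gamma$; one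 exists since $K$ is algebraically closed). The initial form of $f$ with respect to $\gamma$ is $\operatorname{in}_\gamma(f)=\sum_{\mathbf u\in S'}\operatorname{res}(c_{\mathbf u}s(-v(c_{\mathbf u})))x^{\mathbf u}\in k[x_1^{\pm1},\dots,x_n^{\pm1}]$, where $S'\subseteq S$ is the set of $\mathbf u\in S$ at which $v(c_{\mathbf u})+\langle\mathbf u,\gamma\rangle$ is minimal (and $\operatorname{in}_\gamma(0)=0$). The initial ideal $\operatorname{in}_\gamma(I)$ is the ideal of $k[x_1^{\pm1},\dots,x_n^{\pm1}]$ generated by $\{\operatorname{in}_\gamma(f)\mid f\in I\}$. *)

(* Defs.v *)
From HB Require Import structures.
From mathcomp Require Import all_boot all_order all_algebra.
From mathcomp Require Import finmap monalg.

Set Implicit Arguments.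
Unset Strict Implicit.
Unset Printing Implicit Defensive.

Import Order.TTheory GRing.Theory Num.Theory.

Local Open Scope ring_scope.
Local Open Scope quotient_scope.

(* Ordered abelian groups: totally ordered abelian groups with a translation  *)
(* invariant order.  Totality is a field of the mixin because a join with     *)
(* [Order.Total] would conflict with the existing [Num.RealDomain].           *)

HB.mixin Record POrderedZmodule_isOrderedZmodule G
    of Num.POrderedZmodule G := {
  ozmod_le_total : forall x y : G, (x <= y) || (y <= x);
  ozmod_lerD2l : forall x y z : G, x <= y -> z + x <= z + y
}.

#[short(type="orderedZmodType")]
HB.structure Definition OrderedZmodule :=
  {G of POrderedZmodule_isOrderedZmodule G & Num.POrderedZmodule G}.

(* [option G] stands for G with a point None = oo added, which is larger than *)
(* all elements of G and absorbing for addition.                              *)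

Section Infinity.
Variable G : orderedZmodType.

Definition vadd (a b : option G) : option G :=
  if a is Some x then if b is Some y then Some (x + y) else None else None.

Definition vle (a b : option G) : bool :=
  if b is Some y then if a is Some x then x <= y else false else true.

Definition vlt (a b : option G) : bool := ~~ vle b a.

Definition vmin (a b : option G) : option G := if vle a b then a else b.

End Infinity.

Record valuation (K : fieldType) (G : orderedZmodType) := Valuation {
  valuation_fun :> K -> option G;
  valuation_eq0 : forall x, valuation_fun x = None <-> x = 0;
  valuationM : forall x y,
    valuation_fun (x * y) = vadd (valuation_fun x) (valuation_fun y);
  valuationD : forall x y,
    vle (vmin (valuation_fun x) (valuation_fun y)) (valuation_fun (x + y));
  valuation_surj : forall a, exists x, valuation_fun x = a
}.

Record cross_section (K : fieldType) (G : orderedZmodType)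
    (v : valuation K G) := CrossSection {
  cross_section_fun :> G -> K;
  cross_sectionD : forall a b,
    cross_section_fun (a + b) = cross_section_fun a * cross_section_fun b;
  cross_sectionK : forall a, v (cross_section_fun a) = Some a
}.

Section OrderedZmoduleTheory.
Variable G : orderedZmodType.
Implicit Types (x y : G) (a b c : option G).

Lemma ozmod_comparable x y : x >=< y.
Proof. exact: ozmod_le_total. Qed.

Lemma ozmod_ltNge x y : (x < y) = ~~ (y <= x).
Proof. exact: (comparable_ltNge (ozmod_comparable x y)). Qed.

Lemma ozmod_addr_ge0 x y : 0 <= x -> 0 <= y -> 0 <= x + y.
Proof.
move=> x0 y0; apply: (le_trans x0); rewrite -{1}[x]addr0.
exact: ozmod_lerD2l.
Qed.

Lemma ozmod_addr_gt0 x y : 0 <= x -> 0 < y -> 0 < x + y.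
Proof.
move=> x0 y0; rewrite lt_neqAle ozmod_addr_ge0 ?(ltW y0) // andbT.
apply/eqP => xy0; have := ozmod_lerD2l _ _ y x0.
by rewrite addr0 addrC -xy0 (lt_geF y0).
Qed.

Lemma ozmod_oppr_ge0 x : x <= 0 -> 0 <= - x.
Proof. by move=> /(ozmod_lerD2l _ _ (- x)); rewrite addNr addr0. Qed.

Lemma ozmod_double_eq0 x : x + x = 0 -> x = 0.
Proof.
move=> xx; case: (comparable_ltgtP (ozmod_comparable x 0)) => // x0.
  have nx0 : 0 < - x.
    by rewrite lt_neqAle ozmod_oppr_ge0 ?ltW // eq_sym oppr_eq0 lt_eqF.
  have := ozmod_addr_gt0 (ltW nx0) nx0.
  by rewrite -opprD xx oppr0 ltxx.
by have := ozmod_addr_gt0 (ltW x0) x0; rewrite xx ltxx.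
Qed.

Lemma vle_trans a b c : vle a b -> vle b c -> vle a c.
Proof. by case: a b c => [a|] [b|] [c|] //=; apply: le_trans. Qed.

Lemma vle_vmin a b c : vle a b -> vle a c -> vle a (vmin b c).
Proof. by rewrite /vmin; case: ifP. Qed.

End OrderedZmoduleTheory.

Section ResidueField.
Variables (K : fieldType) (G : orderedZmodType) (v : valuation K G).

Lemma valuation0 : v 0 = None.
Proof. exact/valuation_eq0. Qed.

Lemma valuation1 : v 1 = Some 0.
Proof.
have := valuationM v 1 1; rewrite mulr1.
case E: (v 1) => [a|] /=; last first.
  by move/valuation_eq0/eqP: E; rewrite oner_eq0.
by case=> /(congr1 (fun x => x - a)); rewrite subrr addrK => <-.
Qed.

Lemma valuationN x : v (- x) = v x.
Proof.
have vN1 : v (-1) = Some 0.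
  have := valuationM v (-1) (-1); rewrite mulrNN mulr1 valuation1.
  by case: (v (-1)) => [a|] //= [] /esym /ozmod_double_eq0 ->.
by rewrite -mulN1r valuationM vN1; case: (v x) => //= a; rewrite add0r.
Qed.

Lemma valuationV x : x != 0 -> vadd (v x^-1) (v x) = Some 0.
Proof. by move=> x0; rewrite -valuationM mulVf // valuation1. Qed.

Definition val_ring : {pred K} := [pred x | vle (Some 0) (v x)].

Lemma val_ring_closed : subring_closed val_ring.
Proof.
split=> [|x y|x y]; rewrite !inE; first by rewrite valuation1 /=.
  move=> x0 y0; apply: vle_trans (valuationD v x (- y)).
  by rewrite valuationN vle_vmin.
rewrite valuationM; case: (v x) (v y) => [a|] [b|] //=.
exact: ozmod_addr_ge0.
Qed.

HB.instance Definition _ := GRing.isSubringClosed.Build K val_ring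
  val_ring_closed.

Record val_ring_type : predArgType :=
  ValRing { val_ring_val : K; _ : val_ring_val \in val_ring }.

HB.instance Definition _ := [isSub for val_ring_val].
HB.instance Definition _ := [Choice of val_ring_type by <:].
HB.instance Definition _ := [SubChoice_isSubComNzRing of val_ring_type by <:].

Definition val_max : {pred val_ring_type} :=
  [pred x | vlt (Some 0) (v (val x))].

Lemma val_maxE x : (x \in val_max) = vlt (Some 0) (v (val x)).
Proof. by []. Qed.

Lemma val_max_closed : idealr_closed val_max.
Proof.
split=> [||a x y]; rewrite !val_maxE /vlt.
- by rewrite rmorph0 valuation0.
- by rewrite rmorph1 valuation1 /= lexx.
move=> x0 y0; rewrite rmorphD rmorphM.
have: ~~ vle (v (val a * val x)) (Some 0).
  have := valP a; rewrite inE valuationM.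
  case: (v (val a)) (v (val x)) x0 => [b|] [c|] //=.
  by rewrite -!ozmod_ltNge => ? ?; apply: ozmod_addr_gt0.
move: y0 (valuationD v (val a * val x) (val y)); rewrite /vmin.
by case: ifP => _ y0 H ax0;
   [apply: contra ax0 | apply: contra y0]; apply: vle_trans.
Qed.

HB.instance Definition _ := isIdealr.Build val_ring_type val_max
  val_max_closed.

Definition residue_field := {ideal_quot val_max}.

HB.instance Definition _ := GRing.ComNzRing.on residue_field.

(* The junk value is 0 outside the valuation ring. *)
Definition residue (x : K) : residue_field :=
  \pi_residue_field (insubd (0 : val_ring_type) x).

Definition residue_inv (q : residue_field) : residue_field :=
  residue (val (repr q))^-1.

Lemma residue_mulVf (q : residue_field) : q != 0 -> residue_inv q * q = 1.
Proof.
rewrite /residue_inv /residue; set x := repr q.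
have -> : q = \pi_residue_field x by rewrite reprK.
move=> nz; have: x \notin val_max.
  by apply: contraNN nz; rewrite -{1}[x]subr0 Quotient.idealrBE rmorph0.
rewrite val_maxE /vlt negbK => vx.
have xn0 : val x != 0.
  by apply/eqP => x0; move: vx; rewrite x0 valuation0.
have Vx : (val x)^-1 \in val_ring.
  have := valuationV xn0; rewrite inE.
  case: (v (val x)^-1) (v (val x)) vx => [b|] [c|] //= c0 [] /eqP.
  by rewrite addr_eq0 => /eqP ->; exact: ozmod_oppr_ge0.
rewrite -rmorphM -[RHS](rmorph1 (\pi_residue_field)); congr (\pi _).
apply: val_inj; rewrite rmorphM rmorph1 [X in X * _](_ : _ = (val x)^-1) ?mulVf //.
exact: (insubdK _ Vx).
Qed.

Lemma residue_inv0 : residue_inv 0 = 0.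
Proof.
rewrite /residue_inv /residue; set x := repr _.
have mx : x \in val_max.
  by rewrite -[x]subr0 Quotient.idealrBE reprK rmorph0.
rewrite -[RHS](rmorph0 (\pi_residue_field)); congr (\pi _).
apply: val_inj; rewrite val_insubd rmorph0; case: ifP => // Vx.
have [->|xn0] := eqVneq (val x) 0; first exact: invr0.
move: mx Vx (valuationV xn0); rewrite val_maxE !inE /vlt.
case: (v (val x)^-1) (v (val x)) => [b|] [c|] //= c0 b0 [] bc.
by move: c0; rewrite -ozmod_ltNge => /(ozmod_addr_gt0 b0); rewrite bc ltxx.
Qed.

HB.instance Definition _ := GRing.ComNzRing_isField.Build residue_field
  residue_mulVf residue_inv0.

End ResidueField.

(* Laurent polynomials in n variables: finitely supported families of         *)
(* coefficients indexed by Z^n.  The ring structure of [monalg] only covers   *)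
(* monoids of exponents without nontrivial units, hence it is redone here.    *)

Definition laurent (n : nat) (R : comNzRingType) := {malg R[(int ^ n)%type]}.

Notation "{ 'laurent' R [ n ] }" := (laurent n R)
  (at level 0, R, n at level 2, format "{ 'laurent'  R [ n ] }") : type_scope.

Section LaurentRing.
Variables (n : nat) (R : comNzRingType).

HB.instance Definition _ := GRing.Lmodule.on (laurent n R).

Implicit Types f g h : {laurent R[n]}.

Definition laurent_one : {laurent R[n]} := mkmalgU 0%R 1.

Definition laurent_mul f g : {laurent R[n]} :=
  \sum_(u <- msupp f) \sum_(w <- msupp g) mkmalgU (u + w)%R (f@_u * g@_w).

Lemma laurent_mulw (d1 d2 : {fset (int ^ n)%type}) f g :
  (msupp f `<=` d1)%fset -> (msupp g `<=` d2)%fset ->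
  laurent_mul f g =
  \sum_(u <- d1) \sum_(w <- d2) mkmalgU (u + w)%R (f@_u * g@_w).
Proof.
move=> le1 le2; rewrite /laurent_mul (big_fset_incl _ le1) /=.
  apply: eq_bigr => u _; apply: big_fset_incl => // w _ /mcoeff_outdom ->.
  by rewrite mulr0 monalgU0.
move=> u _ /mcoeff_outdom fu; rewrite big1 // => w _.
by rewrite fu mul0r monalgU0.
Qed.

Lemma laurent_mulC : commutative laurent_mul.
Proof.
move=> f g; rewrite /laurent_mul exchange_big; apply: eq_bigr => u _.
by apply: eq_bigr => w _; rewrite addrC mulrC.
Qed.

Lemma laurent_mulUU a b u w :
  laurent_mul (mkmalgU u a) (mkmalgU w b) = mkmalgU (u + w)%R (a * b).
Proof. by rewrite (laurent_mulw msuppU_le msuppU_le) !big_seq_fset1 !mcoeffUU. Qed.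

Lemma laurent_mulDl : left_distributive laurent_mul +%R.
Proof.
move=> f1 f2 g.
rewrite (laurent_mulw (msuppD_le _ _) (fsubset_refl _)).
rewrite [X in _ = X + _](laurent_mulw (fsubsetUl _ (msupp f2)) (fsubset_refl _)).
rewrite [X in _ = _ + X](laurent_mulw (fsubsetUr (msupp f1) _) (fsubset_refl _)).
rewrite -big_split; apply: eq_bigr => u _ /=.
rewrite -big_split; apply: eq_bigr => w _ /=.
by rewrite mcoeffD mulrDl monalgUD.
Qed.

Lemma laurent_mul0g : left_zero 0 laurent_mul.
Proof. by move=> g; rewrite /laurent_mul msupp0 big_seq_fset0. Qed.

Lemma laurent_mul_suml (I : Type) (r : seq I) (F : I -> {laurent R[n]}) g :
  laurent_mul (\sum_(i <- r) F i) g = \sum_(i <- r) laurent_mul (F i) g.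
Proof.
exact: (big_morph (laurent_mul^~ g) (fun _ _ => laurent_mulDl _ _ _)
  (laurent_mul0g g)).
Qed.

Lemma laurent_mul_sumr (I : Type) (r : seq I) (F : I -> {laurent R[n]}) g :
  laurent_mul g (\sum_(i <- r) F i) = \sum_(i <- r) laurent_mul g (F i).
Proof.
by rewrite laurent_mulC laurent_mul_suml; apply: eq_bigr => i _;
   rewrite laurent_mulC.
Qed.

Lemma laurent_mul1g : left_id laurent_one laurent_mul.
Proof.
move=> g; rewrite [in LHS](monalgE g) laurent_mul_sumr [RHS]monalgE.
by apply: eq_bigr => u _; rewrite laurent_mulUU add0r mul1r.
Qed.

Lemma laurent_mulA : associative laurent_mul.
Proof.
pose m := locked laurent_mul; have mE : laurent_mul = m by rewrite /m -lock.
have mUU := laurent_mulUU; have msl := laurent_mul_suml.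
have msr := laurent_mul_sumr; rewrite mE in mUU msl msr *.
move=> f g h; rewrite [f]monalgE [g]monalgE [h]monalgE.
rewrite !msl; apply: eq_bigr => u _.
rewrite !msr [RHS](eq_bigr _ (fun t _ => msl _ _ _ _)) exchange_big.
apply: eq_bigr => w _; rewrite !msr.
by apply: eq_bigr => t _; rewrite !mUU addrA mulrA.
Qed.

Lemma laurent_one_neq0 : laurent_one != 0.
Proof. by rewrite monalgU_eq0 oner_eq0. Qed.

HB.instance Definition _ := GRing.Zmodule_isComNzRing.Build (laurent n R)
  laurent_mulA laurent_mulC laurent_mul1g laurent_mulDl laurent_one_neq0.

End LaurentRing.

Definition laurent_eval (n : nat) (R : fieldType) (f : {laurent R[n]})
    (z : (R ^ n)%type) : R :=
  \sum_(u <- msupp f) f@_u * \prod_(i < n) z i ^ u i.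

(* Ideals are Prop-valued subsets; the unit ideal is allowed. *)

Record is_ideal (R : comNzRingType) (I : R -> Prop) : Prop := IsIdeal {
  ideal0 : I 0;
  idealD : forall a b, I a -> I b -> I (a + b);
  idealM : forall a b, I b -> I (a * b)
}.

Definition is_proper (R : comNzRingType) (I : R -> Prop) : Prop :=
  ~ (forall a, I a).

Definition ideal_gen (R : comNzRingType) (A : R -> Prop) : R -> Prop :=
  fun a => forall I : R -> Prop, is_ideal I -> (forall b, A b -> I b) -> I a.

Section Tropical.
Variables (K : fieldType) (G : orderedZmodType) (v : valuation K G) (n : nat).
Implicit Types (f : {laurent K[n]}) (gamma : (G ^ n)%type).

Definition pairing (u : (int ^ n)%type) gamma : G :=
  \sum_(i < n) gamma i *~ u i.

Definition trop_term f gamma (u : (int ^ n)%type) : option G :=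
  vadd (v f@_u) (Some (pairing u gamma)).

Definition trop f gamma : option G :=
  \big[@vmin G/None]_(u <- msupp f) trop_term f gamma u.

Definition tropical_root f gamma : Prop :=
  f = 0 \/
  exists u w, [/\ u \in msupp f, w \in msupp f, u != w,
                  trop_term f gamma u = trop f gamma
                & trop_term f gamma w = trop f gamma].

Variable s : cross_section v.

(* [odflt 0 (v c)] is the value in G of a nonzero coefficient c. *)
Definition initial_form f gamma : {laurent (residue_field v)[n]} :=
  \sum_(u <- msupp f | trop_term f gamma u == trop f gamma)
     mkmalgU u (residue v (f@_u * s (- odflt 0 (v f@_u)))).

Definition initial_ideal (I : {laurent K[n]} -> Prop) gamma :
    {laurent (residue_field v)[n]} -> Prop :=
  ideal_gen (fun g => exists2 f, I f & g = initial_form f gamma).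

End Tropical.

(* Main.v *)
From HB Require Import structures.
Require Import Defs.
From mathcomp Require Import all_boot all_order all_algebra.
From mathcomp Require Import finmap monalg.
From mathcomp Require Import boolp.
From mathcomp Require classical_sets.
From mathcomp Require Import closed_field ring.

Set Implicit Arguments.
Unset Strict Implicit.
Unset Printing Implicit Defensive.

Import Order.TTheory GRing.Theory Num.Theory.

Local Open Scope ring_scope.

(** Only the passage from a proper initial ideal to a zero is deep.  The other
two implications are computations with the reduction map f |-> f (s(gamma) x)
modulo the maximal ideal.  If f(z) = 0 with v(z) = gamma, then a unique term of
minimal valuation could not cancel ([root_tropical_root]).  If the initial
ideal contains 1, then, since the reductions of I form an ideal that contains
the initial forms ([reductions_ideal]), some f in I reduces to 1, and the
minimum in trop(f)(gamma) is attained at the exponent 0 only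
([tropical_roots_initial_ideal_proper]).

For the deep implication, rescale the variables by s(gamma), so that gamma
becomes 0, and let O be the valuation ring and m its maximal ideal.  The
initial ideal is proper only if I does not meet 1 + m O[x, x^-1].  What is
needed is then a Nullstellensatz over O ([valuative_nullstellensatz]): an ideal
I of a K-algebra A generated by a finite family x has a zero with coordinates
in O as soon as I does not meet 1 + m O[x].  It is applied to the family of all
x_i and x_i^-1, which forces the coordinates to be units of O.

To prove it, enlarge I to an ideal maximal among those that avoid 1 + m O[x].
It is prime; let L be the fraction field of the quotient ([field_avoiding]).
By Chevalley ([chevalley]), every extension of L carries a valuation ring W
that contains O and all x_j and in which the elements of m stay nonunits.
Thus L contains a point of the affine scheme with coordinates in W, and it has
to be moved into K without losing integrality or the relations
between its coordinates.  This is the existential closedness of algebraically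
closed valued fields, obtained by removing one transcendental at a time
([descend_point]).

One step ([specialize_step]) takes an algebraically closed E, an element t of W
outside E, and a finite family y of elements of W algebraic over E(t).
Multiplication by y on the finite-dimensional algebra E(t)[y] gives commuting
matrices over E(t).  Specialise t to an element a of E; the joint eigenvalues
of the specialised matrices satisfy all polynomial relations of y.  The point
is to choose a such that one tuple of eigenvalues is integral.  A polynomial
has an integral root exactly when some coefficient of positive degree divides
the constant one ([root_unit_coef], [exists_root_in]), and a can be chosen to
preserve finitely many such divisibilities ([specialization_point]).  This
controls one combination sum_j c^j y_j; doing it for many c and interpolating
controls all the y_j at once.

Algebraic closures enter only through countable fields.  So L is replaced by a
countable subfield L0, closed under the solution of polynomial equations over K
and containing the coefficients of certificates that witness the maximality of
the chosen ideal: for x_j different from z in K, some multiple of x_j - z lies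
in 1 + m O[x].  The point z obtained over the field L0 meets K satisfies
the relations with coefficients in that field, among them the certificate for
x_j and z_j if these differed; evaluated at z it reads 0 = 1 + (an element of
m).  Hence x_j = z_j for all j, so z satisfies all the relations in I, also
those with coefficients outside L0 ([coordinates_in_base]). *)

(** * Valuation rings and divisibility *)

Definition val_subring (F : fieldType) (W : {pred F}) :=
  forall x, x \notin W -> x^-1 \in W.

Section SameVal.
Variables (F : fieldType) (W : subringClosed F).
Hypothesis Wval : val_subring W.
Implicit Types x y z : F.

(** Equality of values, for nonzero elements; the value group itself never appears:
    v(y) <= v(x) is expressed by x / y \in W. *)
Definition same_val x y := [&& x != 0, y != 0, x / y \in W & y / x \in W].

Lemma same_val_refl x : x != 0 -> same_val x x.
Proof. by move=> x0; rewrite /same_val x0 mulfV ?rpred1. Qed.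

Lemma same_val_sym x y : same_val x y = same_val y x.
Proof. by rewrite /same_val; case: eqP; case: eqP; rewrite //= andbC. Qed.

Lemma divW_trans x y z : y != 0 -> x / y \in W -> y / z \in W -> x / z \in W.
Proof. by move=> y0 xy yz; have := rpredM xy yz; rewrite mulrA divfK. Qed.

Lemma same_val_trans y x z : same_val x y -> same_val y z -> same_val x z.
Proof.
case/and4P=> x0 y0 xy yx /and4P[_ z0 yz zy].
by rewrite /same_val x0 z0 (divW_trans y0 xy yz) (divW_trans y0 zy yx).
Qed.

Lemma same_valM x y x' y' :
  same_val x x' -> same_val y y' -> same_val (x * y) (x' * y').
Proof.
case/and4P=> x0 y0 xy yx /and4P[a0 b0 ab ba].
by rewrite /same_val !mulf_neq0 //= -!mulf_div; apply/andP; split; apply: rpredM.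
Qed.

Lemma divW_total x y : x != 0 -> y != 0 -> (x / y \in W) || (y / x \in W).
Proof. by move=> x0 y0; case: (boolP (x / y \in W)) => //= /Wval; rewrite invf_div. Qed.

(** The side condition says that v(x) < v(y): this is the strict case of the
    ultrametric inequality. *)
Lemma same_val_add x y : x != 0 -> (y == 0) || (x / y \notin W) -> same_val (x + y) x.
Proof.
move=> x0 /orP[/eqP->|xy]; first by rewrite addr0 same_val_refl.
have y0 : y != 0 by apply: contraNneq xy => ->; rewrite invr0 mulr0 rpred0.
have yx := Wval xy; rewrite invf_div in yx.
have s0 : x + y != 0.
  apply: contraNneq xy => /eqP; rewrite addr_eq0 => /eqP->.
  by rewrite mulNr (mulfV y0) rpredN rpred1.
rewrite /same_val s0 x0 mulrDl mulfV //= rpredD ?rpred1 //=.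
have /orP[H|H] := divW_total y0 s0.
  have -> : x / (x + y) = 1 - y / (x + y).
    by rewrite -[1](mulfV s0) -mulrBl addrK.
  by rewrite rpredB ?rpred1.
case/negP: xy; have -> : x / y = (x + y) / y - 1.
  by rewrite mulrDl (mulfV y0) addrK.
by rewrite rpredB ?rpred1.
Qed.

(** Valuation rings are integrally closed: otherwise x = x^k (x^-1)^(k-1) is a
    product of two elements of W. *)
Lemma val_subring_root x k : (0 < k)%N -> x ^+ k \in W -> x \in W.
Proof.
case: k => // k _ xk; apply/negPn/negP => xW; case/negP: (xW).
have x0 : x != 0 by apply: contraNneq xW => ->; rewrite rpred0.
suff -> : x = x ^+ k.+1 * x^-1 ^+ k by rewrite rpredM // rpredX // Wval.
by rewrite exprS exprVn mulfK // expf_neq0.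
Qed.

Lemma exists_divW_min (T : eqType) (f : T -> F) (s : seq T) :
  s != [::] -> (forall i, i \in s -> f i != 0) ->
  exists2 i, i \in s & forall j, j \in s -> f j / f i \in W.
Proof.
elim: s => // i s IH _ f0.
have fi0 : f i != 0 by apply: f0; rewrite mem_head.
have [->|s0] := eqVneq s [::].
  by exists i; rewrite ?mem_head // => j; rewrite inE => /eqP->; rewrite mulfV ?rpred1.
have [j js|j js jP] := IH s0; first by apply: f0; rewrite inE js orbT.
have fj0 : f j != 0 by apply: f0; rewrite inE js orbT.
have /orP[H|H] := divW_total fi0 fj0.
  exists j; first by rewrite inE js orbT.
  by move=> l; rewrite inE => /orP[/eqP->|/jP].
exists i; first by rewrite mem_head.
move=> l; rewrite inE => /orP[/eqP->|/jP lj]; first by rewrite mulfV ?rpred1.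
exact: divW_trans fj0 lj H.
Qed.

(** With i > 0 chosen such that q`_i has least value among the coefficients of
    positive degree, q(x) = 0 expresses q`_0 / q`_i through elements of W. *)
Lemma root_unit_coef (q : {poly F}) x : q != 0 -> root q x -> x \in W ->
  exists i, [/\ (0 < i)%N, q`_i != 0 & q`_0 / q`_i \in W].
Proof.
move=> q0 /eqP qx xW.
pose s := [seq i <- iota 1 (size q) | q`_i != 0].
have qsum : q`_0 = - \sum_(1 <= i < (size q).+1) q`_i * x ^+ i.
  move: qx; rewrite (@horner_coef_wide _ (size q).+1) //.
  rewrite -(big_mkord predT (fun i => q`_i * x ^+ i)) /= big_ltn //.
  by rewrite expr0 mulr1 => /eqP; rewrite addr_eq0 => /eqP.
have sP j : j \in s -> q`_j != 0 by rewrite mem_filter => /andP[].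
have [s0|s0] := eqVneq s [::].
  case/negP: q0; apply/eqP/polyP => i; rewrite coef0.
  have H j : (0 < j)%N -> q`_j = 0.
    move=> j0; have [jq|jq] := leqP (size q) j; first by rewrite nth_default.
    apply/eqP; apply/negPn; apply/negP => qj.
    have : j \in s by rewrite mem_filter qj mem_iota j0 add1n ltnS ltnW.
    by rewrite s0.
  case: i => [|i]; last exact: H.
  by rewrite qsum big_nat big1 ?oppr0 // => i /andP[/H-> _]; rewrite mul0r.
have [i is_ iP] := exists_divW_min s0 sP.
exists i; move: (is_); rewrite mem_filter mem_iota => /and3P[-> -> _]; split=> //.
rewrite qsum mulNr rpredN mulr_suml big_nat rpred_sum // => j /andP[j0 jq].
rewrite mulrAC rpredM ?rpredX //.
have [->|qj] := eqVneq q`_j 0; first by rewrite mul0r rpred0.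
by apply: iP; rewrite mem_filter qj mem_iota j0 add1n.
Qed.

End SameVal.

Section SplitRoot.
Variables (E : closedFieldType) (V : subringClosed E).
Hypothesis Vval : val_subring V.

Definition nonunit x := (x == 0) || (x^-1 \notin V).

Lemma nonunit_V x : nonunit x -> x \in V.
Proof.
by case/orP=> [/eqP->|/Vval]; [exact: rpred0|rewrite invrK].
Qed.

Lemma nonunitM x y : x \in V -> nonunit y -> nonunit (x * y).
Proof.
move=> xV; rewrite /nonunit; case: eqP => [->|/eqP y0]; first by rewrite mulr0 eqxx.
have [->|x0] := eqVneq x 0; first by rewrite mul0r eqxx.
rewrite mulf_eq0 (negPf x0) (negPf y0) /=; apply: contra => H.
by have := rpredM xV H; rewrite invfM mulVKf.
Qed.

Lemma nonunitD x y : nonunit x -> nonunit y -> nonunit (x + y).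
Proof.
move=> nx ny; have [->|x0] := eqVneq x 0; first by rewrite add0r.
have [->|y0] := eqVneq y 0; first by rewrite addr0.
have /orP[H|H] := divW_total Vval x0 y0.
  have -> : x + y = (x / y + 1) * y by rewrite mulrDl divfK // mul1r.
  by rewrite nonunitM // rpredD ?rpred1.
have -> : x + y = (1 + y / x) * x by rewrite mulrDl divfK // mul1r.
by rewrite nonunitM // rpredD ?rpred1.
Qed.

(** Converse of [root_unit_coef] over an algebraically closed field. *)
Lemma exists_root_in (q : {poly E}) i : (0 < i)%N -> q`_i != 0 ->
  q`_0 / q`_i \in V -> exists2 x, root q x & x \in V.
Proof.
move=> i0 qi qV; have [r qE] := closed_field_poly_normal q.
case: (boolP (has (mem V) r)) => [/hasP[x xr xV]|/hasPn rV].
  by exists x; rewrite // qE rootE hornerZ horner_prod (big_rem x) //= hornerXsubC subrr mul0r mulr0.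
have lq0 : lead_coef q != 0.
  by rewrite lead_coef_eq0; apply: contraNneq qi => ->; rewrite coef0.
(* If every root z is outside V, then each factor X - z is -z (1 - z^-1 X) with
   z^-1 a nonunit, so the constant coefficient has strictly least value. *)
have [c [c0 [q0 qj]]] : exists c, c != 0 /\
   let p := \prod_(z <- r) ('X - z%:P) in
   p`_0 = c /\ forall j, (0 < j)%N -> nonunit (p`_j / c).
  elim: r rV {qE} => [|z r IH] rV.
    exists 1; rewrite oner_eq0 big_nil; split=> //=; rewrite coef1; split=> //.
    by move=> [|j] // _; rewrite coef1 /= mul0r /nonunit eqxx.
  have zV : z \notin V by apply: (rV z); rewrite mem_head.
  have z0 : z != 0 by apply: contraNneq zV => ->; rewrite rpred0.
  have [j jr|c [c0 /= [p0 pj]]] := IH; first by apply: rV; rewrite inE jr orbT.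
  exists (- z * c); rewrite mulf_neq0 ?oppr_eq0 //; split=> //=.
  rewrite big_cons; set p := \prod_(_ <- _) _ in p0 pj *.
  split; first by rewrite mulrBl coefB coefXM coefCM /= sub0r p0 mulNr.
  move=> [|j] // _; rewrite mulrBl coefB coefXM coefCM /=.
  have -> : (p`_j - z * p`_j.+1) / (- z * c) = - (p`_j / c) * z^-1 + p`_j.+1 / c.
    by field; rewrite z0 c0 oppr_eq0.
  apply: (nonunitD _ (pj _ _)) => //; apply: nonunitM; last by rewrite /nonunit invrK zV orbT.
  by rewrite rpredN; case: j => [|j]; [rewrite p0 mulfV ?rpred1|apply/nonunit_V/pj].
have qk k : q`_k = lead_coef q * (\prod_(z <- r) ('X - z%:P))`_k.
  by rewrite {1}qE coefZ.
have := qj _ i0; rewrite /nonunit; move: qi qV; rewrite !qk q0.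
set p := _`_i; rewrite mulf_eq0 negb_or => /andP[_ p0].
by rewrite -mulf_div mulfV // mul1r invf_div mulf_eq0 (negPf p0) invr_eq0 (negPf c0) /= => ->.
Qed.

End SplitRoot.

(** * Choosing the specialisation of one transcendental *)

Section Approximation.
Variables (F : fieldType) (W : subringClosed F) (E : closedFieldType).
Variables (iota : {rmorphism E -> F}) (t : F).
Hypothesis Wval : val_subring W.
Hypothesis tE : forall e, iota e != t.
Hypothesis tW : t \in W.

(** For p split over E with roots in bs, the value of p at a point x only depends on
    the values of the x - b.  The set A is meant to contain the b for which
    v(x - b) = v(b0 - b); at the others x - b has the value of d. *)
Lemma same_val_monomial (bs : seq E) (A : pred E) (p : {poly E}) :
    p != 0 -> (forall b, root p b -> b \in bs) -> forall b0,
  exists c n, c != 0 /\ forall x d,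
    {in bs, forall b, same_val W (x - iota b) (if A b then iota (b0 - b) else d)} ->
  same_val W (map_poly iota p).[x] (iota c * d ^+ n).
Proof.
have [r ->] := closed_field_poly_normal p => p0.
have l0 : lead_coef p != 0 by apply: contraNneq p0 => ->; rewrite scale0r.
move=> rbs b0.
have {p0}rbs : {subset r <= bs}.
  by move=> b br; apply: rbs; rewrite rootZ // root_prod_XsubC.
move: (lead_coef p) l0 => c0 c00; elim: r rbs => [|b r IH] rbs.
  exists c0, 0%N; split=> // x d _; rewrite big_nil map_polyZ rmorph1 hornerZ hornerC.
  by rewrite expr0 same_val_refl // mulr1 fmorph_eq0.
have [y yr|c [n [cn0 H]]] := IH; first by apply: rbs; rewrite inE yr orbT.
have bbs : b \in bs by apply: rbs; rewrite mem_head.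
have step x d : {in bs, forall b, same_val W (x - iota b) (if A b then iota (b0 - b) else d)} ->
  same_val W (map_poly iota (c0 *: \prod_(z <- b :: r) ('X - z%:P))).[x]
     ((if A b then iota (b0 - b) else d) * (iota c * d ^+ n)).
  move=> xd; rewrite big_cons scalerAr rmorphM hornerM /= map_polyXsubC hornerXsubC.
  by apply: same_valM; [apply: xd|apply: H].
have [Ab|nAb] := boolP (A b); last first.
  exists c, n.+1; split=> // x d /step; rewrite (negPf nAb).
  by rewrite mulrCA -exprS.
have [bb0|bb0] := eqVneq b0 b.
  exists c, n; split=> // x d /step; rewrite Ab bb0 subrr rmorph0 mul0r.
  by rewrite /same_val eqxx andbF.
exists ((b0 - b) * c), n; split; first by rewrite mulf_neq0 ?subr_eq0.
by move=> x d /step; rewrite Ab rmorphM mulrA.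
Qed.

(** A filter on E: P holds once v(d) is between the value of some nonzero element of
    E below delta and v(delta).  The value of delta need not be attained in E. *)
Definition near_value delta (P : E -> Prop) :=
  exists r, [/\ r != 0, delta / iota r \in W &
    forall d, d != 0 -> delta / iota d \in W -> iota (d / r) \in W -> P d].

Lemma near_value_and delta P Q : near_value delta P -> near_value delta Q -> near_value delta (fun d => P d /\ Q d).
Proof.
move=> [r [r0 dr Pr]] [s [s0 ds Qs]].
have ir0 : iota r != 0 by rewrite fmorph_eq0.
have is0 : iota s != 0 by rewrite fmorph_eq0.
have /orP[H|H] := divW_total Wval ir0 is0.
  exists r; split=> // d d0 dd idr; split; first exact: Pr.
  by apply: Qs => //; rewrite fmorph_div (divW_trans ir0 _ H) // -fmorph_div.
exists s; split=> // d d0 dd ids; split; last exact: Qs.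
by apply: Pr => //; rewrite fmorph_div (divW_trans is0 _ H) // -fmorph_div.
Qed.

Lemma near_value_all delta (T : eqType) (s : seq T) (P : T -> E -> Prop) :
  delta \in W -> (forall i, i \in s -> near_value delta (P i)) ->
  near_value delta (fun d => forall i, i \in s -> P i d).
Proof.
move=> dW; elim: s => [|i s IH] nP.
  by exists 1; rewrite oner_eq0 rmorph1 divr1.
have [r [r0 dr rP]] : near_value delta (fun d => P i d /\ forall j, j \in s -> P j d).
  apply: near_value_and; first by apply: nP; rewrite mem_head.
  by apply: IH => j js; apply: nP; rewrite inE js orbT.
exists r; split=> // d d0 dd ddr j; have [Pi Ps] := rP d d0 dd ddr.
by rewrite inE => /orP[/eqP->|/Ps].
Qed.

(** The element a imitates t.  Let b0 be a root of one of the ps nearest to t and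
    delta = t - b0.  For each root b, v(t - b) is the minimum of v(delta) and
    v(b0 - b), so each v(p(t)) is v(c_p) + n_p v(delta) with c_p in E.  Now take
    a = b0 + d u with u a generic unit: v(p(a)) is v(c_p) + n_p v(d) provided v(d)
    is at most v(delta) and above the values v(b0 - b) < v(delta).  An inequality
    between these that holds for delta holds for d when v(d) is close enough to
    v(delta) from below, because the value group of E is divisible. *)
Lemma specialization_point (ps : seq {poly E}) :
  exists a : E,
    (forall p, p \in ps -> p != 0 -> p.[a] != 0) /\
    (forall p q, p \in ps -> q \in ps -> p != 0 ->
       (map_poly iota q).[t] / (map_poly iota p).[t] \in W ->
       iota (q.[a] / p.[a]) \in W).
Proof.
have rootsP (p : {poly E}) : exists r : seq E, p != 0 -> forall b, root p b -> b \in r.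
  have [r pE] := closed_field_poly_normal p; exists r => p0 b.
  rewrite pE rootZ ?root_prod_XsubC // lead_coef_eq0 //.
have [rt rtP] := choice rootsP.
(* With 0 among the bs, delta is in W, so 1 is a lower bound for delta and the
   conditions on d below can be met. *)
pose bs := 0 :: flatten [seq rt p | p <- ps].
have bsP p b : p \in ps -> p != 0 -> root p b -> b \in bs.
  move=> pps p0 pb; rewrite inE; apply/orP; right; apply/flatten_mapP.
  by exists p => //; apply: rtP.
have tb b : t - iota b != 0 by rewrite subr_eq0 eq_sym tE.
have [|b0 b0bs b0max] := @exists_divW_min _ _ Wval _ (fun b => (t - iota b)^-1) bs isT.
  by move=> b _; rewrite invr_eq0.
set delta := t - iota b0.
have dmax b : b \in bs -> delta / (t - iota b) \in W.
  by move=> /b0max; rewrite invrK mulrC.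
have dW : delta \in W.
  have := rpredM (dmax 0 (mem_head _ _)) tW.
  by have := tb 0; rewrite rmorph0 subr0 => t0; rewrite divfK.
have d0 : delta != 0 by apply: tb.
pose A b := iota (b0 - b) / delta \notin W.
have An b : A b -> iota (b0 - b) != 0.
  by apply: contraNneq => ->; rewrite mul0r rpred0.
have simt : {in bs, forall b, same_val W (t - iota b) (if A b then iota (b0 - b) else delta)}.
  move=> b bb; have tE' : t - iota b = delta + iota (b0 - b).
    by rewrite /delta rmorphB addrA subrK.
  case: ifPn => Ab.
    by rewrite tE' addrC; apply: same_val_add => //; [apply: An|apply/orP; right].
  rewrite /same_val tb d0 dmax // andbT /= tE' mulrDl mulfV // rpredD ?rpred1 //.
  by rewrite negbK in Ab.
(* These conditions are closed under raising v(d) towards v(delta). *)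
have [d [dn0 [ddW dA dps]]] : exists d, d != 0 /\ [/\ delta / iota d \in W,
    forall b, b \in bs -> A b -> iota (d / (b0 - b)) \in W &
    forall p, p \in ps -> forall q, q \in ps -> p != 0 -> q != 0 ->
       (map_poly iota q).[t] / (map_poly iota p).[t] \in W ->
       forall a, {in bs, forall b, same_val W (iota a - iota b) (if A b then iota (b0 - b) else iota d)} ->
       iota (q.[a] / p.[a]) \in W].
  suff [r [r0 dr H]] : near_value delta (fun d => 
    (forall b, b \in bs -> A b -> iota (d / (b0 - b)) \in W) /\
    (forall p, p \in ps -> forall q, q \in ps -> p != 0 -> q != 0 ->
       (map_poly iota q).[t] / (map_poly iota p).[t] \in W ->
       forall a, {in bs, forall b, same_val W (iota a - iota b) (if A b then iota (b0 - b) else iota d)} ->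
       iota (q.[a] / p.[a]) \in W)).
    have [|H1 H2] := H r r0 dr; first by rewrite mulfV // rmorph1 rpred1.
    by exists r.
  apply: near_value_and.
    apply: near_value_all => // b bb.
    have [Ab|nAb] := boolP (A b); last first.
      by exists 1; rewrite oner_eq0 rmorph1 divr1.
    exists (b0 - b); split=> //; first by rewrite -(fmorph_eq0 iota) An.
    have /orP[//|] := divW_total Wval d0 (An b Ab).
    by rewrite (negPf Ab).
  apply: near_value_all => // p pps; apply: near_value_all => // q qps.
  have triv : near_value delta (fun _ => True) by exists 1; rewrite oner_eq0 rmorph1 divr1.
  have eqW x y : x = y -> x \in W -> y \in W by move->.
  have weak (P : E -> Prop) : (forall d, P d) -> near_value delta P.
    by move=> Pd; have [r [r0 dr _]] := triv; exists r.
  have [->|p0] := eqVneq p 0; first by apply: weak.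
  have [->|q0] := eqVneq q 0; first by apply: weak.
  have [qpt|qpt] := boolP ((map_poly iota q).[t] / (map_poly iota p).[t] \in W); last first.
    by apply: weak.
  have [cp [np [cp0 Hp]]] := same_val_monomial A p0 (fun b => @bsP p b pps p0) b0.
  have [cq [nq [cq0 Hq]]] := same_val_monomial A q0 (fun b => @bsP q b qps q0) b0.
  have icp0 : iota cp != 0 by rewrite fmorph_eq0.
  have icq0 : iota cq != 0 by rewrite fmorph_eq0.
  have quot x y x' y' : same_val W x x' -> same_val W y y' -> x / y \in W -> x' / y' \in W.
    case/and4P=> x0 x'0 _ xx /and4P[y0 y'0 yy _] xy.
    exact: (divW_trans y0 (divW_trans x0 xx xy) yy).
  have qpt' := quot _ _ _ _ (Hq _ _ simt) (Hp _ _ simt) qpt.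
  have fin d : d != 0 -> (iota cq * iota d ^+ nq) / (iota cp * iota d ^+ np) \in W ->
    forall a, {in bs, forall b, same_val W (iota a - iota b) (if A b then iota (b0 - b) else iota d)} ->
       iota (q.[a] / p.[a]) \in W.
    move=> dn0 H a simd; rewrite fmorph_div -!horner_map.
    have s1 := Hq _ _ simd; have s2 := Hp _ _ simd.
    by apply: (quot _ _ _ _ _ _ H); rewrite same_val_sym.
  have [le_qp|lt_pq] := leqP nq np.
    exists 1; rewrite oner_eq0 rmorph1 divr1; split=> // d dn0 ddW _ _ _ _; apply: fin => //.
    have id0 : iota d != 0 by rewrite fmorph_eq0.
    move: (rpredM qpt' (rpredX (np - nq) ddW)); apply: eqW.
    rewrite -(subnKC le_qp) !exprD expr_div_n.
    by rewrite addKn; field; rewrite ?icp0 ?id0 ?d0 ?expf_neq0.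
  have k0 : (0 < nq - np)%N by rewrite subn_gt0.
  (* the inequality says exactly that v(r) <= v(delta) *)
  have [r rk] : exists r, r ^+ (nq - np) = cp / cq.
    have [r] := solve_monicpoly (fun i => if i == 0%N then cp / cq else 0) k0.
    move: k0; case: (_ - _)%N => // k _; rewrite big_ord_recl /= expr0 mulr1 big1 ?addr0.
      by exists r.
    by move=> i _; rewrite mul0r.
  have r0 : r != 0.
    have : r ^+ (nq - np) != 0 by rewrite rk mulf_neq0 ?invr_eq0.
    by rewrite expf_eq0 k0.
  have ir0 : iota r != 0 by rewrite fmorph_eq0.
  exists r; split=> //.
    apply: (val_subring_root Wval k0); move: qpt'; apply: eqW.
    rewrite expr_div_n -rmorphXn rk fmorph_div -{1}(subnKC (ltnW lt_pq)) exprD.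
    by field; rewrite ?icp0 ?icq0 ?d0 ?expf_neq0.
  move=> d dn0 _ drW _ _ _; apply: fin => //.
  have id0 : iota d != 0 by rewrite fmorph_eq0.
  move: (rpredX (nq - np) drW); apply: eqW; rewrite -rmorphXn expr_div_n rk invf_div.
  rewrite -{2}(subnKC (ltnW lt_pq)) exprD !(rmorphM, fmorph_div, rmorphXn).
  by field; rewrite ?icp0 ?icq0 ?id0 ?expf_neq0.
(* Take u with prod_b (u - (b - b0) / d) = 1 over the b with (b - b0) / d in W.
   Then u is integral over W, hence in W, and all the factors are units; so a - b
   has the value of d for these b. *)
have eqW x y : x = y -> x \in W -> y \in W by move->.
have id0 : iota d != 0 by rewrite fmorph_eq0.
pose bs' := [seq b <- bs | iota ((b - b0) / d) \in W].
pose P := \prod_(b <- bs') ('X - ((b - b0) / d)%:P).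
have bs'_gt0 : (0 < size bs')%N.
  have : b0 \in bs' by rewrite mem_filter subrr mul0r rmorph0 rpred0.
  by case: (bs').
have [u Pu] : exists u, root (P - 1) u.
  apply/closed_rootP; have szP : size P = (size bs').+1 by rewrite size_prod_XsubC.
  by rewrite size_polyDl szP ?size_polyN ?size_poly1 ?ltnS // eqSS -lt0n.
have {}Pu : \prod_(b <- bs') (u - (b - b0) / d) = 1.
  move: Pu; rewrite rootE hornerD hornerN hornerC subr_eq0 => /eqP Pu1; rewrite -[RHS]Pu1.
  by rewrite horner_prod; apply: eq_bigr => b _; rewrite hornerXsubC.
have uW : iota u \in W.
  apply/negPn/negP => uW.
  have u0 : iota u != 0 by apply: contraNneq uW => ->; rewrite rpred0.
  have sP b : b \in bs' -> same_val W (iota (u - (b - b0) / d)) (iota u).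
    rewrite mem_filter => /andP[bW _]; rewrite rmorphB; apply: same_val_add => //.
    rewrite oppr_eq0; case: eqP => //= /eqP b0'.
    by rewrite invrN mulrN rpredN; apply: contra uW => H; rewrite -[iota u](divfK b0') rpredM.
  have : same_val W (iota 1) (iota u ^+ size bs').
    rewrite -Pu; elim: (bs') sP => [|b l IH] sP.
      by rewrite big_nil expr0 rmorph1 same_val_refl ?oner_eq0.
    rewrite big_cons exprS rmorphM; apply: same_valM; first by apply: sP; rewrite mem_head.
    by apply: IH => b' b'l; apply: sP; rewrite inE b'l orbT.
  case/and4P=> _ _ _; rewrite rmorph1 divr1 => /val_subring_root H; case/negP: uW; apply: H => //.
have uunit b : b \in bs' -> same_val W (iota (u - (b - b0) / d)) 1.
  move=> bb; have bW c : c \in bs' -> iota (u - (c - b0) / d) \in W.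
    by rewrite mem_filter => /andP[cW _]; rewrite rmorphB rpredB.
  have Pr : (u - (b - b0) / d) * \prod_(c <- rem b bs') (u - (c - b0) / d) = 1.
    by rewrite -[RHS]Pu [RHS](big_rem b bb).
  have n0 : u - (b - b0) / d != 0.
    by apply/eqP => n0; move/eqP: Pr; rewrite n0 mul0r eq_sym oner_eq0.
  rewrite /same_val fmorph_eq0 n0 oner_eq0 divr1 bW //= -fmorphV mul1r.
  have -> : (u - (b - b0) / d)^-1 = \prod_(c <- rem b bs') (u - (c - b0) / d).
    by apply: (mulfI n0); rewrite mulfV.
  rewrite rmorph_prod big_seq rpred_prod // => c cr; apply: bW; exact: mem_rem cr.
pose a := b0 + d * u.
have simd : {in bs, forall b, same_val W (iota a - iota b) (if A b then iota (b0 - b) else iota d)}.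
  move=> b bb; rewrite -rmorphB.
  have [bW|bW] := boolP (b \in bs').
    have -> : a - b = d * (u - (b - b0) / d) by rewrite /a; field.
    have s1 : same_val W (iota (d * (u - (b - b0) / d))) (iota d).
      rewrite rmorphM -[X in same_val _ _ X]mulr1; apply: same_valM; last exact: uunit.
      by rewrite same_val_refl.
    case: ifPn => // Ab; apply: (same_val_trans s1).
    rewrite /same_val id0 An //= -!fmorph_div dA // -opprB mulNr rmorphN rpredN.
    by move: bW; rewrite mem_filter => /andP[].
  have nbW : iota ((b0 - b) / d) \notin W.
    by move: bW; rewrite mem_filter bb andbT -(opprB b) mulNr rmorphN rpredN.
  have -> : A b.
    apply: contra nbW => H; rewrite fmorph_div; exact: divW_trans H ddW.
  have -> : a - b = (b0 - b) + d * u by rewrite /a; ring.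
  rewrite rmorphD; apply: same_val_add => //.
    by apply: contraNneq nbW => H; rewrite fmorph_div H mul0r rpred0.
  rewrite fmorph_eq0; case: eqP => //= /eqP du0.
  apply: contra nbW => H; move: (rpredM H uW); apply: eqW.
  have u0 : u != 0 by apply: contraNneq du0 => ->; rewrite mulr0.
  by rewrite !rmorphM fmorphV; field; rewrite !fmorph_eq0 ?u0 ?dn0.
have nz p : p \in ps -> p != 0 -> p.[a] != 0.
  move=> pps p0; have [c [n [c0 H]]] := same_val_monomial A p0 (fun b => @bsP p b pps p0) b0.
  by have /and4P[] := H _ _ simd; rewrite horner_map fmorph_eq0.
exists a; split=> // p q pps qps p0 qp.
have [->|q0] := eqVneq q 0; first by rewrite horner0 mul0r rmorph0 rpred0.
exact: (dps p pps q qps p0 q0 qp a simd).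
Qed.

End Approximation.

(** * Multiplication matrices of an algebraic family *)

Section StableFamily.
Variables (R : idomainType) (F : fieldType) (ev : {rmorphism R -> F}).
Hypothesis ev_eq0 : forall a, (ev a == 0) = (a == 0).

(** The powers y^k with k < D span a space stable under y; D may exceed the degree, so
    that one D serves a whole family. *)
Lemma power_basis (y : F) (p : {poly R}) D : p != 0 -> root (map_poly ev p) y ->
    (size p <= D)%N ->
  exists (h : R) (B : nat -> nat -> R), h != 0 /\
    forall k, (k < D)%N -> ev h * y * y ^+ k = \sum_(l < D) ev (B k l) * y ^+ l.
Proof.
move=> p0 /eqP py pD.
have sp0 : (0 < size p)%N by rewrite size_poly_gt0.
pose q := p * 'X^(D.+1 - size p).
have sq : size q = D.+1.
  by rewrite /q size_mulXn // subnK // (leq_trans pD).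
have qy : (map_poly ev q).[y] = 0 by rewrite rmorphM hornerM py mul0r.
have h0 : q`_D != 0.
  by rewrite -[D]/(D.+1.-1) -sq -lead_coefE lead_coefM lead_coefXn mulr1 lead_coef_eq0.
exists q`_D, (fun k l => if k.+1 == D then - q`_l else (l == k.+1)%:R * q`_D); split=> // k kD.
rewrite -mulrA -exprS; have [->|kD'] := eqVneq k.+1 D.
  move: qy; rewrite (@horner_coef_wide _ D.+1) ?big_ord_recr /=; last first.
    by rewrite size_map_poly_id0 ?sq // ev_eq0 lead_coefM lead_coefXn mulr1 lead_coef_eq0.
  rewrite coef_map addrC => /eqP; rewrite addr_eq0 => /eqP->.
  by rewrite -sumrN; apply: eq_bigr => l _; rewrite coef_map rmorphN mulNr.
have k1D : (k.+1 < D)%N by rewrite ltn_neqAle kD' kD.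
rewrite (bigD1 (Ordinal k1D)) //= eqxx mul1r big1 ?addr0 // => l /eqP lk.
case: eqP => [E|]; last by rewrite mul0r rmorph0 mul0r.
by case: lk; apply: val_inj.
Qed.

Variables (J : finType) (y : J -> F).

(** The entries of w span a space stable under each y j, over the fraction field of
    R; h is a common denominator of the matrices A j / h. *)
Definition stable N (w : 'rV[F]_N) (h : R) (A : J -> 'M[R]_N) :=
  [/\ w != 0, h != 0 & forall j, w *m map_mx ev (A j) = (ev h * y j) *: w].

(** The monomials in the y j with all exponents below a common bound. *)
Lemma stable_monomials :
  (forall j, exists2 p : {poly R}, p != 0 & root (map_poly ev p) (y j)) ->
  exists N (w : 'rV[F]_N) h A, stable w h A.
Proof.
move=> /fin_all_exists2[p p0 py].
pose D := (\max_j size (p j)).+1.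
have /fin_all_exists[h] j : exists h (B : nat -> nat -> R), h != 0 /\
    forall k, (k < D)%N -> ev h * y j * y j ^+ k = \sum_(l < D) ev (B k l) * y j ^+ l.
  by apply: power_basis (p0 j) (py j) _; rewrite ltnW // ltnS leq_bigmax.
move=> /fin_all_exists[B] hB.
pose T := {ffun J -> 'I_D}.
pose upd (e : T) j l : T := [ffun i => if i == j then l else e i].
pose m (e : T) := \prod_j y j ^+ e j.
have mE e j : m e = y j ^+ e j * \prod_(i | i != j) y i ^+ e i.
  by rewrite /m (bigD1 j).
have mupd e j l : m (upd e j l) = y j ^+ l * \prod_(i | i != j) y i ^+ e i.
  rewrite (mE _ j) ffunE eqxx; congr (_ * _); apply: eq_bigr => i ij.
  by rewrite ffunE (negPf ij).
pose A j := \matrix_(a, b) ((\prod_(i | i != j) h i) *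
  \sum_(l < D) (enum_val a == upd (enum_val b) j l)%:R * B j (enum_val b j) l) : 'M[R]_#|T|.
exists #|T|, (\row_a m (enum_val a)), (\prod_j h j), A; split.
- apply/eqP => /rowP/(_ (enum_rank [ffun=> ord0])); rewrite !mxE enum_rankK /m.
  by rewrite big1 => [/eqP|j _]; rewrite ?oner_eq0 // ffunE expr0.
- by rewrite prodf_seq_neq0; apply/allP => j _; rewrite (hB j).1.
move=> j; apply/rowP => b; rewrite !mxE.
have -> : ev (\prod_j h j) * y j * m (enum_val b) =
    ev (\prod_(i | i != j) h i) * (ev (h j) * y j * m (enum_val b)).
  by rewrite (bigD1 j) //= rmorphM; ring.
rewrite (eq_bigr (fun a : 'I_#|T| => ev (\prod_(i | i != j) h i) * \sum_(l < D)
   (m (enum_val a) * (enum_val a == upd (enum_val b) j l)%:R) * ev (B j (enum_val b j) l))); last first.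
  move=> a _; rewrite !mxE rmorphM mulrCA; congr (_ * _).
  rewrite rmorph_sum mulr_sumr; apply: eq_bigr => l _.
  by rewrite rmorphM rmorph_nat mulrA.
rewrite -mulr_sumr; congr (_ * _); rewrite exchange_big /=.
rewrite (mE (enum_val b) j) !mulrA (hB j).2 ?ltn_ord // mulr_suml.
apply: eq_bigr => l _; rewrite -mulr_suml mulrC -mulrA; congr (_ * _).
rewrite (bigD1 (enum_rank (upd (enum_val b) j l))) //= enum_rankK eqxx mulr1 big1 ?addr0 ?mupd //.
move=> a /eqP ab; case: eqP => [E|]; last by rewrite mulr0.
by case: ab; rewrite -E enum_valK.
Qed.

(** A linear relation X between the entries of w with X k 0 != 0 allows the k-th
    entry to be dropped: it is a combination, with denominator X k 0, of the others. *)
Lemma stable_independent N (w : 'rV[F]_N) h A : stable w h A ->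
  exists N' (w' : 'rV[F]_N') h' A', stable w' h' A' /\
    forall X : 'cV[R]_N', w' *m map_mx ev X = 0 -> X = 0.
Proof.
elim: N w h A => [|N IH] w h A [w0 h0 Aw].
  by case/eqP: w0; apply/rowP => -[].
have [indep|] := pselect (forall X : 'cV[R]_N.+1, w *m map_mx ev X = 0 -> X = 0).
  by exists N.+1, w, h, A.
move=> /existsNP[X] /not_implyP[wX X0].
have [k Xk] : exists k, X k 0 != 0.
  apply/existsP; rewrite -[[exists k, _]]negbK negb_exists; apply/negP => /forallP H.
  by apply: X0; apply/colP => k; rewrite mxE; apply/eqP; have := H k; rewrite negbK.
pose C := \matrix_(a < N, b < N.+1)
  (if b == k then - X (lift k a) 0 else if b == lift k a then X k 0 else 0).
have wC : col' k w *m map_mx ev C = ev (X k 0) *: w.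
  apply/rowP => b; rewrite !mxE; have [->|bk] := eqVneq b k.
    move/rowP/(_ 0): wX; rewrite !mxE (bigD1 k) //= !mxE => /eqP.
    rewrite addr_eq0 mulrC => /eqP->; rewrite -sumrN.
    rewrite (reindex_omap (lift k) (unlift k)) /=; last first.
      by move=> i ik; case: unliftP ik => [j ->|->] //=; rewrite eqxx.
    apply: eq_big => [i|i _]; first by rewrite eq_sym neq_lift liftK eqxx.
    by rewrite !mxE eqxx rmorphN mulrN.
  case: (unliftP k b) bk => [b' ->|->]; last by rewrite eqxx.
  move=> bk; rewrite (bigD1 b') //= !mxE (negPf bk) eqxx big1 ?addr0 1?mulrC //.
  move=> i ib; rewrite !mxE (negPf bk) (inj_eq lift_inj) eq_sym (negPf ib).
  by rewrite rmorph0 mulr0.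
apply: (IH (col' k w) (X k 0 * h) (fun j => C *m col' k (A j))); split.
- apply: contraNneq w0 => w0; move: wC; rewrite w0 mul0mx => /esym/eqP.
  by rewrite scaler_eq0 ev_eq0 (negPf Xk).
- by rewrite mulf_neq0.
move=> j; rewrite map_mxM mulmxA wC -scalemxAl rmorphM -mulrA -scalerA.
congr (_ *: _); apply/rowP => b; have /rowP/(_ (lift k b)) := Aw j.
by rewrite !mxE => <-; apply: eq_bigr => i _; rewrite !mxE.
Qed.

End StableFamily.

(** * Joint eigenvectors and interpolation *)

Section JointEigenvector.
Variable C : closedFieldType.

Lemma eigenvector_in n m (A : 'M[C]_n) (U : 'M[C]_(m, n)) :
    U != 0 -> (U *m A <= U)%MS ->
  exists a, (U :&: eigenspace A a)%MS != 0.
Proof.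
move=> U0 UA; have [M BA] : exists M, row_base U *m A = M *m row_base U.
  by apply/submxP; rewrite (eqmxMr _ (eq_row_base U)) eq_row_base.
have r0 : (0 < \rank U)%N by rewrite lt0n mxrank_eq0.
have /closed_rootP[a] : size (char_poly M) != 1%N.
  by rewrite size_char_poly; case: (\rank U) r0.
rewrite -eigenvalue_root_char => /eigenvalueP[v vM v0]; exists a.
have vB0 : v *m row_base U != 0 by rewrite mulmx_free_eq0 ?row_base_free.
apply: contraNneq vB0 => cap0; rewrite -submx0 -cap0 sub_capmx.
rewrite (submx_trans (submxMl _ _)) ?eq_row_base //=.
by apply/eigenspaceP; rewrite -mulmxA BA mulmxA vM scalemxAl.
Qed.

(** The intersection of U with an eigenspace of one A i is stable under the others,
    which commute with it; so U can be shrunk for one index at a time. *)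
Lemma joint_eigenvector n m (J : finType) (A : J -> 'M[C]_n) (U : 'M[C]_(m, n)) :
    U != 0 -> (forall j, (U *m A j <= U)%MS) ->
    (forall i j, A i *m A j = A j *m A i) ->
  exists v : 'rV[C]_n, [/\ v != 0, (v <= U)%MS &
    exists mu : J -> C, forall j, v *m A j = mu j *: v].
Proof.
move=> U0 UA AC; suff H (js : seq J) : exists v : 'rV[C]_n, [/\ v != 0, (v <= U)%MS &
    forall j, j \in js -> exists a, v *m A j = a *: v].
  have [v [v0 vU vJ]] := H (enum J).
  have /fin_all_exists[mu muP] j : exists a, v *m A j = a *: v by apply: vJ; rewrite mem_enum.
  by exists v; split=> //; exists mu.
elim: js m U U0 UA => [|i js IH] m U U0 UA.
  have [k Uk] : exists k, row k U != 0.
    have /row_subPn[k] : ~~ (U <= (0 : 'M[C]_n))%MS by rewrite submx0.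
    by rewrite submx0; exists k.
  by exists (row k U); rewrite row_sub.
have [a U'0] := eigenvector_in U0 (UA i).
have [|v [v0 vU' vjs]] := IH _ _ U'0.
  move=> j; rewrite sub_capmx.
  rewrite (submx_trans _ (UA j)) ?submxMr ?capmxSl //=.
  apply: submx_trans (submxMr _ (capmxSr _ _)) _.
  by apply/eigenspaceP; rewrite -mulmxA AC mulmxA (eigenspaceP (submx_refl _)) scalemxAl.
move: vU'; rewrite sub_capmx => /andP[vU /eigenspaceP va].
exists v; split=> // j; rewrite inE => /orP[/eqP->|]; last exact: vjs.
by exists a.
Qed.

End JointEigenvector.

Section Interpolation.
Variables (E : closedFieldType) (V : subringClosed E).
Hypothesis Vval : val_subring V.

Definition residually_distinct a b := (b != a) && ((b - a)^-1 \in V).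

(** The next element u solves prod_c (u - c) = 1 over 0 and the earlier c, so it is
    integral and differs from each of them by a unit. *)
Lemma exists_residually_distinct M : exists cs : seq E,
  [/\ size cs = M, {subset cs <= V} & pairwise residually_distinct cs].
Proof.
elim: M => [|M [cs [sz csV csP]]]; first by exists [::].
have [u Pu] : exists u, root (\prod_(c <- 0 :: cs) ('X - c%:P) - 1) u.
  apply/closed_rootP.
  by rewrite size_polyDl size_prod_XsubC ?size_polyN ?size_poly1.
have {}Pu : \prod_(c <- 0 :: cs) (u - c) = 1.
  move: Pu; rewrite rootE hornerD hornerN hornerC subr_eq0 => /eqP Pu1.
  rewrite -[RHS]Pu1 horner_prod; apply: eq_bigr => b _; rewrite hornerXsubC //.
have uV : u \in V.
  apply/negPn/negP => uV.
  have u0 : u != 0 by apply: contraNneq uV => ->; rewrite rpred0.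
  have : same_val V 1 (u ^+ (size cs).+1).
    rewrite -{1}Pu -[(size cs).+1]/(size (0 :: cs)).
    have : {subset 0 :: cs <= V}.
      by move=> c; rewrite inE => /orP[/eqP->|/csV//]; rewrite rpred0.
    elim: (0 :: cs) => [|c l IH] lV; first by rewrite big_nil expr0 same_val_refl ?oner_eq0.
    rewrite big_cons exprS; apply: same_valM; last by apply: IH => b bl; apply: lV; rewrite inE bl orbT.
    apply: same_val_add => //; rewrite oppr_eq0; case: eqP => //= /eqP c0.
    rewrite invrN mulrN rpredN; apply: contra uV => H.
    by rewrite -[u](divfK c0) rpredM // lV ?mem_head.
  by case/and4P=> _ _ _; rewrite divr1 => /(val_subring_root Vval); rewrite (negPf uV) => /(_ isT).
have uc c : c \in cs -> (c != u) && ((u - c)^-1 \in V).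
  move=> ccs; have H : (u - c) * \prod_(b <- rem c (0 :: cs)) (u - b) = 1.
    by rewrite -[RHS]Pu [RHS](big_rem c) // inE ccs orbT.
  have n0 : u - c != 0 by apply/eqP => n0; move/eqP: H; rewrite n0 mul0r eq_sym oner_eq0.
  rewrite eq_sym -subr_eq0 n0 /=; have -> : (u - c)^-1 = \prod_(b <- rem c (0 :: cs)) (u - b).
    by apply: (mulfI n0); rewrite mulfV.
  rewrite big_seq rpred_prod // => b /mem_rem.
  by rewrite inE => /orP[/eqP->|/csV bV]; rewrite rpredB ?rpred0.
exists (u :: cs); split=> /=; first by rewrite sz.
  by move=> c; rewrite inE => /orP[/eqP->|/csV].
rewrite csP andbT; apply/allP => c /uc /andP[cu H].
by rewrite /residually_distinct cu -opprB invrN rpredN.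
Qed.

(** Newton interpolation: the divided differences only divide by units of V. *)
Lemma interpolation (cs : seq E) (p : {poly E}) :
    (size p <= size cs)%N -> {subset cs <= V} ->
    pairwise residually_distinct cs ->
    (forall c, c \in cs -> p.[c] \in V) ->
  p \is a polyOver V.
Proof.
elim: cs p => [|c cs IH] p /=.
  by rewrite leqn0 size_poly_eq0 => /eqP-> *; rewrite rpred0.
move=> sp csV /andP[/allP cP csP] pV.
have cV : c \in V by apply: csV; rewrite mem_head.
have /factor_theorem[q pq] : root (p - p.[c]%:P) c by rewrite rootE !hornerE subrr.
have pE : p = q * ('X - c%:P) + p.[c]%:P by rewrite -pq subrK.
have qV : q \is a polyOver V.
  apply: IH => //.
  - have [->|q0] := eqVneq q 0; first by rewrite size_poly0.
    rewrite -ltnS; apply: leq_trans _ sp.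
    have -> : (size q).+1 = size (q * ('X - c%:P)).
      by rewrite size_Mmonic ?monicXsubC // size_XsubC addn2.
    rewrite -pq; apply: leq_trans (size_polyD _ _) _.
    rewrite geq_max leqnn size_polyN size_polyC /=; case: eqP => //= /eqP pc.
    by rewrite lt0n size_poly_eq0; apply: contraNneq pc => ->; rewrite horner0.
  - by move=> b bcs; apply: csV; rewrite inE bcs orbT.
  move=> b bcs; have /andP[bc bcV] := cP b bcs.
  have -> : q.[b] = (p.[b] - p.[c]) * (b - c)^-1.
    rewrite [in p.[b]]pE !hornerE addrK mulfK //.
    by rewrite subr_eq0.
  by rewrite rpredM // rpredB // pV ?mem_head // inE bcs orbT.
rewrite pE rpredD ?rpredM ?polyOverC ?pV ?mem_head //.
by rewrite polyOverXsubC.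
Qed.

End Interpolation.

(** * Specialising one transcendental *)

(** Polynomials in variables indexed by J are encoded as lists of coefficients and
    exponents, which can be evaluated in any ring along any map f of the coefficients. *)
Definition meval (R : Type) (S : comNzRingType) (f : R -> S) (J : finType)
    (x : J -> S) (r : seq (R * (J -> nat))) : S :=
  \sum_(p <- r) f p.1 * \prod_j x j ^+ p.2 j.

Definition evalp (E F : fieldType) (iota : {rmorphism E -> F}) (t : F) :
  {poly E} -> F := horner_eval t \o map_poly iota.

HB.instance Definition _ (E F : fieldType) (iota : {rmorphism E -> F}) (t : F) :=
  GRing.RMorphism.copy (evalp iota t) (horner_eval t \o map_poly iota).

Lemma evalpC (E F : fieldType) (iota : {rmorphism E -> F}) t c :
  evalp iota t c%:P = iota c.
Proof. by rewrite /evalp /= /horner_eval map_polyC hornerC. Qed.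

Lemma evalpX (E F : fieldType) (iota : {rmorphism E -> F}) t :
  evalp iota t 'X = t.
Proof. by rewrite /evalp /= /horner_eval map_polyX hornerX. Qed.

Lemma pigeonhole (T : finType) (I : eqType) (s : seq I) (f : I -> T) k :
  (#|T| * k < size s)%N -> exists x, (k < count (fun i => f i == x) s)%N.
Proof.
move=> ks; apply/existsP; rewrite -[[exists x, _]]negbK negb_exists.
apply/negP => /forallP H; move: ks; rewrite ltnNge => /negP; apply.
have <- : (\sum_x count (fun i => f i == x) s = size s)%N.
  elim: s {H} => [|i s IH] /=; first by rewrite big1.
  rewrite big_split /= IH (bigD1 (f i)) //= eqxx big1 ?addn0 ?add1n //.
  by move=> x /negPf xi; rewrite eq_sym xi.
rewrite -sum_nat_const; apply: leq_sum => x _.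
by rewrite leqNgt H.
Qed.

Section MonomialMatrix.
Variables (R : comNzRingType) (J : finType) (N : nat) (h : R) (A : J -> 'M[R]_N.+1).

Lemma eigen_monomial (S : comNzRingType) (v : 'rV[S]_N.+1) (M : J -> 'M[S]_N.+1)
    (mu : J -> S) (e : J -> nat) :
  (forall j, v *m M j = mu j *: v) ->
  v *m (\prod_j M j ^+ e j) = (\prod_j mu j ^+ e j) *: v.
Proof.
move=> vM; elim/big_ind2: _ => [|a X b Y vX vY|j _].
- by rewrite mulmx1 scale1r.
- by rewrite -[X * Y]/(X *m Y) mulmxA vX -scalemxAl vY scalerA.
elim: (e j) => [|k IH]; first by rewrite !expr0 mulmx1 scale1r.
by rewrite !exprS -[_ * _]/(M j *m _) mulmxA vM -scalemxAl IH scalerA.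
Qed.

(** The polynomial r evaluated at the matrices A j / h and multiplied by h^D, which
    clears the denominators when D bounds the degrees. *)
Definition meval_mx (K : Type) (c : K -> R) (r : seq (K * (J -> nat))) (D : nat) : 'M[R]_N.+1 :=
  \sum_(p <- r) (c p.1 * h ^+ (D - \sum_j p.2 j)) *: \prod_j A j ^+ p.2 j.

Lemma meval_mx_eigen (K : Type) (c : K -> R) (r : seq (K * (J -> nat))) D
    (S : comNzRingType) (phi : {rmorphism R -> S}) (v : 'rV[S]_N.+1) (z : J -> S) :
    all (fun p => \sum_j p.2 j <= D)%N r ->
    (forall j, v *m map_mx phi (A j) = (phi h * z j) *: v) ->
  v *m map_mx phi (meval_mx c r D) = (phi h ^+ D * meval (phi \o c) z r) *: v.
Proof.
move=> rD vA; rewrite /meval_mx /meval.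
elim: r rD => [|p r IH] /=; first by rewrite !big_nil map_mx0 mulmx0 mulr0 scale0r.
case/andP=> pD /IH{}IH; rewrite !big_cons map_mxD mulmxDr IH mulrDr scalerDl.
congr (_ + _); rewrite map_mxZ -scalemxAr.
have -> : map_mx phi (\prod_j A j ^+ p.2 j) = \prod_j (map_mx phi (A j)) ^+ p.2 j.
  by rewrite rmorph_prod; apply: eq_bigr => j _; apply: rmorphXn.
rewrite (eigen_monomial (M := fun j => map_mx phi (A j)) _ vA) scalerA; congr (_ *: _).
have -> : \prod_j (phi h * z j) ^+ p.2 j = phi h ^+ (\sum_j p.2 j) * \prod_j z j ^+ p.2 j.
  by rewrite expr_sum -big_split /=; apply: eq_bigr => j _; rewrite exprMn.
rewrite rmorphM rmorphXn -[in RHS](subnK pD) exprD /=; ring.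
Qed.

End MonomialMatrix.

Section Step.
Variables (F : fieldType) (W : subringClosed F) (E : closedFieldType).
Variables (iota : {rmorphism E -> F}) (t : F).
Hypothesis Wval : val_subring W.

Definition preim_subring : {pred E} := [pred e | iota e \in W].

Lemma preim_subring_closed : subring_closed preim_subring.
Proof.
split=> [|x y|x y]; rewrite !inE ?rmorph1 ?rpred1 // ?rmorphB ?rmorphM.
  exact: rpredB.
exact: rpredM.
Qed.

HB.instance Definition _ := GRing.isSubringClosed.Build E preim_subring preim_subring_closed.

Lemma preim_val_subring : val_subring preim_subring.
Proof. by move=> x; rewrite !inE => /Wval; rewrite fmorphV. Qed.

Hypothesis tE : forall e, iota e != t.
Hypothesis tW : t \in W.

Lemma evalp_eq0 p : (evalp iota t p == 0) = (p == 0).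
Proof.
apply/idP/eqP => [|->]; last by rewrite rmorph0.
have [->//|p0] := eqVneq p 0; have [r {1}->] := closed_field_poly_normal p.
rewrite /evalp /= /horner_eval map_polyZ hornerZ mulf_eq0 fmorph_eq0 lead_coef_eq0 (negPf p0) /=.
rewrite rmorph_prod horner_prod prodf_seq_eq0 => /hasP[b _].
by rewrite /= map_polyXsubC hornerXsubC subr_eq0 eq_sym (negPf (tE b)).
Qed.

(** The family y may be replaced by joint eigenvalues z, at T = a, of its
    multiplication matrices A j / h.  For each c, the combination sum_j c^j y j is
    an integral root of a polynomial Q c over E[t]; a is chosen such that Q c
    still has an integral root at a, for so many values c that one tuple z has to
    serve more than #|J| of them, and then interpolation makes z integral. *)
Lemma specialize_step (J : finType) (y : J -> F) :
    (forall j, y j \in W) ->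
    (forall j, exists2 p : {poly {poly E}}, p != 0 & root (map_poly (evalp iota t) p) (y j)) ->
  exists z : J -> E, (forall j, iota (z j) \in W) /\
    forall r : seq (E * (J -> nat)), meval iota y r = 0 -> meval idfun z r = 0.
Proof.
move=> yW yalg; set ev := evalp iota t.
have [N0 [w0 [h0 [A0 st0]]]] := stable_monomials evalp_eq0 yalg.
have [[|N] [w [h [A [[w_neq0 h_neq0 wA] indep]]]]] := stable_independent evalp_eq0 st0.
  by case/eqP: w_neq0; apply/rowP => -[].
have {}indep m (X : 'M[{poly E}]_(N.+1, m)) : w *m map_mx ev X = 0 -> X = 0.
  move=> wX; apply/matrixP => a b; have : col b X = 0.
    by apply: indep; rewrite colE map_mxM mulmxA wX mul0mx.
  by move/colP/(_ a); rewrite !mxE.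
have AC i j : A i *m A j = A j *m A i.
  apply/eqP; rewrite -subr_eq0; apply/eqP/indep.
  rewrite raddfB /= !map_mxM mulmxBr !mulmxA !wA -!scalemxAl !wA !scalerA.
  by rewrite mulrC subrr.
(* A relation of y gives a matrix over E[T] that kills w at t; by independence it
   is zero, so it is still zero at T = a, where it acts on a joint eigenvector as
   a multiple of the value of the relation at z. *)
have rel (r : seq (E * (J -> nat))) (a : E) (v : 'rV[E]_N.+1) (z : J -> E) : h.[a] != 0 -> v != 0 ->
    (forall j, v *m map_mx (horner_eval a) (A j) = (h.[a] * z j) *: v) ->
    meval iota y r = 0 -> meval idfun z r = 0.
  move=> ha v0 vA yr.
  pose D := (\sum_(p <- r) \sum_j p.2 j)%N.
  have rD : all (fun p : E * (J -> nat) => \sum_j p.2 j <= D)%N r.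
    by rewrite /D; elim: (r) => //= p s IH; rewrite big_cons leq_addr /=;
       apply: sub_all IH => q; move/leq_trans; apply; rewrite leq_addl.
  have X0 : meval_mx h A polyC r D = 0.
    apply: indep; rewrite (meval_mx_eigen polyC (phi := ev) rD wA).
    rewrite (_ : meval _ _ _ = 0) ?mulr0 ?scale0r // -[RHS]yr; apply: eq_bigr => p _.
    by rewrite /= evalpC.
  have := meval_mx_eigen polyC (phi := horner_eval a) rD vA.
  rewrite X0 map_mx0 mulmx0 => /esym/eqP; rewrite scaler_eq0 (negPf v0) orbF mulf_eq0.
  rewrite expf_eq0 /= /horner_eval (negPf ha) andbF /= => /eqP H; rewrite -[RHS]H.
  by apply: eq_bigr => p _; rewrite /= hornerC.
pose idx (j : J) := nat_of_ord (enum_rank j).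
pose Theta c := \sum_j (c ^+ idx j)%:P *: A j.
pose Q c := char_poly (Theta c) \Po (h *: 'X).
have Q0 c : Q c != 0.
  rewrite comp_poly_eq0 ?monic_neq0 ?char_poly_monic //.
  by rewrite size_scale // size_polyX.
have QE (S : comNzRingType) (phi : {rmorphism {poly E} -> S}) c x :
    (map_poly phi (Q c)).[x] = (char_poly (map_mx phi (Theta c))).[phi h * x].
  by rewrite map_comp_poly horner_comp map_polyZ map_polyX hornerZ hornerX map_char_poly.
have Qroot c : root (map_poly ev (Q c)) (\sum_j iota c ^+ idx j * y j).
  rewrite rootE QE -[_ == 0]/(root _ _) -eigenvalue_root_char.
  apply/eigenvalueP; exists w => //.
  rewrite map_mx_sum mulmx_sumr mulr_sumr scaler_suml; apply: eq_bigr => j _.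
  rewrite map_mxZ -scalemxAr wA scalerA; congr (_ *: _).
  rewrite /= evalpC rmorphXn /=; ring.
have [cs [szcs csV csP]] := exists_residually_distinct preim_val_subring
   (#|{ffun J -> 'I_N.+3}| * #|J|).+1.
have [a [aP aPP]] := specialization_point Wval tE tW
  (h :: flatten [seq (Q c : seq {poly E}) | c <- cs]).
have ha : h.[a] != 0 by apply: aP => //; rewrite mem_head.
(* An integral root of Q c at a is, up to the factor h(a), an eigenvalue of the
   specialised Theta c; the A j preserve its eigenspace. *)
have joint c : c \in cs -> exists (z : J -> E), (exists v : 'rV[E]_N.+1, v != 0 /\
    forall j, v *m map_mx (horner_eval a) (A j) = (h.[a] * z j) *: v) /\
    \sum_j c ^+ idx j * z j \in preim_subring.
  move=> ccs; have cW : iota c \in W by apply: (csV c).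
  have [||i [i0 Qi QW]] := root_unit_coef Wval _ (Qroot c).
  - by rewrite map_poly_eq0_id0 // evalp_eq0 lead_coef_eq0.
  - by rewrite rpred_sum // => j _; rewrite rpredM ?rpredX.
  rewrite !coef_map evalp_eq0 /= in Qi QW.
  have Qmem k : (k < size (Q c))%N -> (Q c)`_k \in h :: flatten [seq (Q c : seq {poly E}) | c <- cs].
    by move=> kQ; rewrite inE; apply/orP; right; apply/flatten_mapP; exists c => //; rewrite mem_nth.
  have iQ : (i < size (Q c))%N by rewrite ltnNge; apply: contra Qi => /(nth_default 0)->.
  have Qim := Qmem _ iQ; have Q0m : (Q c)`_0 \in _ := Qmem 0%N (leq_ltn_trans (leq0n _) iQ).
  have [||lam lamr lamV] := @exists_root_in _ _ preim_val_subring (map_poly (horner_eval a) (Q c)) i i0.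
  - by rewrite coef_map /=; apply: aP.
  - by rewrite !coef_map /=; apply: aPP.
  move: lamr; rewrite rootE QE -[_ == 0]/(root _ _) -eigenvalue_root_char /= => eig.
  have AaC i' j' : map_mx (horner_eval a) (A i') *m map_mx (horner_eval a) (A j') =
                 map_mx (horner_eval a) (A j') *m map_mx (horner_eval a) (A i').
    by rewrite -!map_mxM AC.
  have ThC j : map_mx (horner_eval a) (Theta c) *m map_mx (horner_eval a) (A j) =
               map_mx (horner_eval a) (A j) *m map_mx (horner_eval a) (Theta c).
    rewrite !map_mx_sum mulmx_suml mulmx_sumr; apply: eq_bigr => k _.
    by rewrite map_mxZ -scalemxAl -scalemxAr AaC.
  have [|v [v0 /eigenspaceP vTh [mu vmu]]] := joint_eigenvector eig _ AaC.
    by move=> j; apply: comm_mx_stable_eigenspace; apply: ThC.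
  exists (fun j => mu j / h.[a]); split.
    by exists v; split=> // j; rewrite mulrCA mulfV // mulr1.
  suff -> : \sum_j c ^+ idx j * (mu j / h.[a]) = lam by [].
  apply: (mulfI ha); move: vTh.
  rewrite map_mx_sum mulmx_sumr => /eqP; rewrite -subr_eq0.
  rewrite (eq_bigr (fun j => (c ^+ idx j * mu j) *: v)); last first.
    by move=> j _; rewrite map_mxZ -scalemxAr vmu scalerA /= /horner_eval hornerC.
  rewrite -scaler_suml -scalerBl scaler_eq0 (negPf v0) orbF subr_eq0 => /eqP.
  rewrite /= /horner_eval => <-; rewrite mulr_sumr; apply: eq_bigr => j _; field.
  exact: ha.
have {joint} /choice[z zP] c : exists z : J -> E, c \in cs -> (exists v : 'rV[E]_N.+1, v != 0 /\
    forall j, v *m map_mx (horner_eval a) (A j) = (h.[a] * z j) *: v) /\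
    \sum_j c ^+ idx j * z j \in preim_subring.
  have [/joint[z zP]|_] := boolP (c \in cs); first by exists z.
  by exists (fun=> 0).
(* All entries of h(a) z are eigenvalues of specialised A j, so the tuples z c take
   finitely many values and one of them serves more than #|J| values of c. *)
have /fin_all_exists[rt rtP] j : exists s : seq E, (size s <= N.+1)%N /\ forall mu, eigenvalue (map_mx (horner_eval a) (A j)) mu -> mu \in s.
  have [s sE] := closed_field_poly_normal (char_poly (map_mx (horner_eval a) (A j))).
  exists s; move: (sE); rewrite (monicP (char_poly_monic _)) scale1r => sE'; split.
    by rewrite -ltnS -(size_prod_XsubC s id) -sE' size_char_poly.
  by move=> mu; rewrite eigenvalue_root_char sE' root_prod_XsubC.
pose tau c : {ffun J -> 'I_N.+3} := [ffun j => inord (index (h.[a] * z c j) (rt j))].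
have [|tau0 tauP] := @pigeonhole _ _ cs tau #|J|; first by rewrite szcs.
pose cs' := [seq c <- cs | tau c == tau0].
have szcs' : (#|J| < size cs')%N by rewrite size_filter.
have cs'P c : c \in cs' -> (c \in cs) /\ tau c = tau0.
  by rewrite mem_filter => /andP[/eqP].
have eig c j : c \in cs -> h.[a] * z c j \in rt j.
  move=> /zP[[v [v0 vA]] _]; apply: (rtP j).2.
  by apply/eigenvalueP; exists v.
have [c0 c0P] : exists c0, c0 \in cs' by case: (cs') szcs' => // c0 s _; exists c0; rewrite mem_head.
have [c0cs c0tau] := cs'P _ c0P.
have zE c : c \in cs' -> z c =1 z c0.
  move=> /cs'P[ccs ctau] j; apply: (mulfI ha).
  have : tau c j = tau c0 j by rewrite ctau c0tau.
  rewrite !ffunE => /(congr1 val); rewrite /= !inordK; last 2 first.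
  - by rewrite ltnS; apply: leq_trans (index_size _ _) _; apply: leqW (rtP j).1.
  - by rewrite ltnS; apply: leq_trans (index_size _ _) _; apply: leqW (rtP j).1.
  move/(congr1 (nth 0 (rt j))); rewrite !nth_index ?eig //.
exists (z c0); split=> [j|r]; last first.
  by have [[v [v0 vA]] _] := zP _ c0cs; apply: rel ha v0 vA.
pose p := \sum_j z c0 j *: 'X^(idx j).
have pj : p`_(idx j) = z c0 j.
  rewrite coef_sum (bigD1 j) //= coefZ coefXn eqxx mulr1 big1 ?addr0 // => i ij.
  rewrite coefZ coefXn; case: eqP => [/val_inj/enum_rank_inj E'|]; last by rewrite mulr0.
  by rewrite E' eqxx in ij.
suff /polyOverP/(_ (idx j)) : p \is a polyOver preim_subring by rewrite pj.
apply: (@interpolation _ _ cs').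
- apply: leq_trans (ltnW szcs'); apply/leq_sizeP => k kJ.
  rewrite coef_sum big1 // => i _; rewrite coefZ coefXn; case: eqP => [E'|]; last by rewrite mulr0.
  by move: kJ; rewrite E' leqNgt /idx ltn_ord.
- by move=> c /cs'P[/csV].
- exact: (subseq_pairwise (filter_subseq _ _) csP).
move=> c ccs'; rewrite horner_sum (eq_bigr (fun j => c ^+ idx j * z c j)).
  exact: (zP _ (cs'P _ ccs').1).2.
by move=> i _; rewrite hornerZ hornerXn mulrC zE.
Qed.

End Step.

(** * Moving a point into an algebraically closed subfield *)

Section SubfieldType.
Variables (F : fieldType) (P : {pred F}).

Definition subfield_pred of divring_closed P := P.

Hypothesis Pclosed : divring_closed P.

HB.instance Definition _ :=
  GRing.isDivringClosed.Build F (subfield_pred Pclosed) Pclosed.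

Record subfield_type : predArgType :=
  Subfield { subfield_val : F; _ : subfield_val \in subfield_pred Pclosed }.

HB.instance Definition _ := [isSub for subfield_val].
HB.instance Definition _ := [Choice of subfield_type by <:].
HB.instance Definition _ := [SubChoice_isSubComUnitRing of subfield_type by <:].
HB.instance Definition _ := [SubComUnitRing_isSubIntegralDomain of subfield_type by <:].
HB.instance Definition _ := [SubIntegralDomain_isSubField of subfield_type by <:].

Lemma subfield_valP x : x \in P <-> exists e, subfield_val e = x.
Proof.
split=> [xP|[e <-]]; last exact: (valP e).
by exists (Subfield xP).
Qed.

End SubfieldType.

Lemma closed_subfield (F : fieldType) (P : {pred F}) :
    divring_closed P ->
    (forall n (c : nat -> F), (0 < n)%N -> (forall i, c i \in P) ->
       exists2 x, x \in P & x ^+ n = \sum_(i < n) c i * x ^+ i) ->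
  exists (E : closedFieldType) (iota : {rmorphism E -> F}),
    forall x, x \in P <-> exists e, iota e = x.
Proof.
move=> Pdiv Proot; pose S := subfield_type Pdiv.
pose io : {rmorphism S -> F} := \val.
have Sclosed : GRing.closed_field_axiom S.
  move=> n c n0; have [|x xP xn] := Proot n (fun i => val (c i)) n0.
    by move=> i; apply: (valP (c i)).
  exists (Subfield xP : S); apply: val_inj; rewrite -[LHS]/(io _) -[RHS]/(io _).
  rewrite rmorphXn rmorph_sum [LHS]xn.
  by apply: eq_bigr => i _; rewrite rmorphM rmorphXn.
pose Scl : closedFieldType := HB.pack S (Field_isAlgClosed.Build S Sclosed).
exists Scl, io => x.
exact: subfield_valP.
Qed.

Section Tower.
Variables (F : closedFieldType) (W : subringClosed F).
Hypothesis Wval : val_subring W.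

(** E1 is the set of elements of F algebraic over E(t). *)
Lemma closure_adjoin (E : closedFieldType) (iota : {rmorphism E -> F}) (t : F) :
    (forall e, iota e != t) ->
  exists (E1 : closedFieldType) (iota1 : {rmorphism E1 -> F}),
    [/\ forall e, exists e1, iota1 e1 = iota e, exists e1, iota1 e1 = t &
      forall e1, exists2 p : {poly {poly E}}, p != 0 & root (map_poly (evalp iota t) p) (iota1 e1)].
Proof.
move=> tE; pose ev : {rmorphism {poly E} -> F} := evalp iota t.
have ev0 p : (ev p == 0) = (p == 0) := evalp_eq0 tE p.
pose P0 : {pred F} := fun x => `[< exists (g h : {poly E}), h != 0 /\ x = ev g / ev h >].
have P0P x : reflect (exists (g h : {poly E}), h != 0 /\ x = ev g / ev h) (x \in P0) by apply: asboolP.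
have P0div : divring_closed P0.
  split.
  - by apply/P0P; exists 1, 1; rewrite oner_eq0 rmorph1 divr1.
  - move=> x y /P0P[g [h [h0 ->]]] /P0P[g' [h' [h'0 ->]]]; apply/P0P.
    exists (g * h' - g' * h), (h * h'); rewrite mulf_neq0 //; split=> //.
    by rewrite rmorphB !rmorphM; field; rewrite !ev0 h0 h'0.
  move=> x y /P0P[g [h [h0 ->]]] /P0P[g' [h' [h'0 ->]]]; apply/P0P.
  have [->|g'0] := eqVneq g' 0.
    by exists 0, 1; rewrite oner_eq0 !rmorph0 !mul0r invr0 mulr0.
  exists (g * h'), (h * g'); rewrite mulf_neq0 //; split=> //.
  by rewrite !rmorphM; field; rewrite !ev0 h0 h'0 g'0.
pose S := subfield_type P0div.
pose io : {rmorphism S -> F} := \val.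
pose P1 : {pred F} := fun x => `[< algebraicOver io x >].
have P1P x : reflect (algebraicOver io x) (x \in P1) by apply: asboolP.
have P1div : divring_closed P1.
  split; first by apply/P1P; apply: algebraic1.
    by move=> x y /P1P xP /P1P yP; apply/P1P; apply: algebraic_sub.
  by move=> x y /P1P xP /P1P yP; apply/P1P; apply: algebraic_div.
have [|E1 [iota1 iota1P]] := closed_subfield P1div.
  move=> n c n0 cP; have [x xn] := solve_monicpoly c n0; exists x => //.
  apply/P1P/integral_algebraic.
  pose p := 'X^n - \poly_(i < n) c i.
  have sp : size p = n.+1.
    by rewrite size_polyDl size_polyXn // size_polyN ltnS size_poly.
  apply: (@integral_root _ _ _ p).
  - by rewrite -size_poly_gt0 sp.
  - by rewrite rootE hornerD hornerN hornerXn horner_poly xn subrr.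
  apply/(integral_poly io) => i; apply/integral_algebraic/P1P.
  rewrite coefB coefXn coef_poly.
  have P10 : 0 \in P1 by apply/P1P; apply: algebraic0.
  case: eqP => [->|_]; first by rewrite ltnn subr0; case: P1div.
  case: ifP => _; case: P1div => _ sub _; last by apply: sub.
  by apply: sub.
exists E1, iota1; split.
- move=> e; apply/iota1P/P1P; have ieP : iota e \in P0.
    by apply/P0P; exists e%:P, 1; rewrite oner_eq0 rmorph1 divr1 [RHS]evalpC.
  exact: (algebraic_id io (Subfield ieP : S)).
- apply/iota1P/P1P; have tP : t \in P0.
    by apply/P0P; exists 'X, 1; rewrite oner_eq0 rmorph1 divr1 [RHS]evalpX.
  exact: (algebraic_id io (Subfield tP : S)).
move=> e1; have /P1P[p p0 pr] : iota1 e1 \in P1 by apply/iota1P; exists e1.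
have /choice[g /choice[h gh]] i : exists (g h : {poly E}), h != 0 /\ io p`_i = ev g / ev h.
  by apply/P0P; apply: (valP p`_i).
pose n := size p.
pose q := \poly_(i < n) (g i * \prod_(k < n | k != i :> nat) h k).
have Hn0 : \prod_(k < n) h k != 0.
  by rewrite prodf_seq_neq0; apply/allP => k _; rewrite (gh k).1.
have qE : map_poly ev q = ev (\prod_(k < n) h k) *: map_poly io p.
  apply/polyP => i; transitivity (ev q`_i); first exact: coef_map.
  transitivity (ev (\prod_(k < n) h k) * io p`_i); last by rewrite coefZ coef_map.
  rewrite coef_poly; have [lt_in|le_ni] := ltnP i n; last first.
    by rewrite rmorph0 (nth_default _ le_ni) rmorph0 mulr0.
  rewrite (gh i).2 [\prod_(k < n) h k](bigD1 (Ordinal lt_in)) // !rmorphM [val (Ordinal lt_in)]/=.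
  by field; rewrite ev0 (gh i).1.
have qn0 : map_poly ev q != 0.
  by rewrite qE scaler_eq0 ev0 (negPf Hn0) map_poly_eq0.
exists q; first by apply: contraNneq qn0 => ->; rewrite rmorph0.
by rewrite qE rootZ // ev0.
Qed.

(** E' is the algebraic closure of E(ts) in F.  The specialisations are performed in
    the reverse order of the adjunctions: the last element adjoined goes first. *)
Lemma descend_to_subfield (J : finType) (ts : seq F)
    (E : closedFieldType) (iota : {rmorphism E -> F}) :
    {subset ts <= W} ->
  exists (E' : closedFieldType) (iota' : {rmorphism E' -> F}),
    [/\ forall e, exists e', iota' e' = iota e,
        forall x, x \in ts -> exists e', iota' e' = x &
        forall y : J -> F, (forall j, y j \in W) ->
          (forall j, exists e', iota' e' = y j) ->
        exists z : J -> E, (forall j, iota (z j) \in W) /\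
          forall r : seq (E * (J -> nat)),
            meval iota y r = 0 -> meval idfun z r = 0].
Proof.
elim: ts E iota => [|t ts IH] E iota tsW.
  exists E, iota; split=> // [e|y yW /fin_all_exists[z zy]]; first by exists e.
  exists z; split=> [j|r]; first by rewrite zy.
  move=> yr; apply: (fmorph_inj iota); rewrite rmorph0 -[RHS]yr rmorph_sum.
  apply: eq_bigr => p _; rewrite rmorphM rmorph_prod; congr (_ * _).
  by apply: eq_bigr => j _; rewrite rmorphXn zy.
have tW : t \in W by apply: tsW; rewrite mem_head.
have tsW' : {subset ts <= W} by move=> x xts; apply: tsW; rewrite inE xts orbT.
have [[e et]|tE] := pselect (exists e, iota e = t).
  have [E' [iota' [EE' tsE' desc]]] := IH E iota tsW'.
  exists E', iota'; split=> // x; rewrite inE => /orP[/eqP->|/tsE'//].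
  by rewrite -et; apply: EE'.
have {}tE e : iota e != t by apply/eqP => et; apply: tE; exists e.
have [E1 [iota1 [EE1 [e1 e1t] algE1]]] := closure_adjoin tE.
have [E' [iota' [E1E' tsE' desc]]] := IH E1 iota1 tsW'.
exists E', iota'; split.
- by move=> e; have [e' <-] := EE1 e; apply: E1E'.
- by move=> x; rewrite inE => /orP[/eqP->|/tsE'//]; rewrite -e1t; apply: E1E'.
move=> y yW yE'; have [z1 [z1W z1r]] := desc y yW yE'.
have [z [zW zr]] := specialize_step Wval tE tW z1W (fun j => algE1 (z1 j)).
exists z; split=> // r yr; apply: zr.
have /choice[k kE] := EE1.
have : meval idfun z1 [seq (k p.1, p.2) | p <- r] = 0.
  apply: z1r; rewrite -[RHS]yr /meval big_map; apply: eq_bigr => p _.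
  by rewrite /= kE.
move/(congr1 iota1); rewrite rmorph0 => <-; rewrite /meval big_map rmorph_sum.
apply: eq_bigr => p _; rewrite rmorphM rmorph_prod /= kE; congr (_ * _).
by apply: eq_bigr => j _; rewrite rmorphXn.
Qed.

Lemma descend_point (J : finType) (E : closedFieldType) (iota : {rmorphism E -> F})
    (x : J -> F) : (forall j, x j \in W) ->
  exists z : J -> E, (forall j, iota (z j) \in W) /\
    forall r : seq (E * (J -> nat)), meval iota x r = 0 -> meval idfun z r = 0.
Proof.
move=> xW; have tsW : {subset [seq x j | j : J] <= W} by move=> _ /imageP[j _ ->].
have [E' [iota' [_ tsE' desc]]] := @descend_to_subfield J _ _ iota tsW.
by apply: desc => // j; apply: tsE'; apply: image_f.
Qed.

End Tower.

(** * Extension of valuation rings *)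

(** Zorn's lemma for sets containing A0 with a property P stable under unions of
    nonempty chains. *)
Lemma zorn_subset (T : Type) (P : (T -> Prop) -> Prop) (A0 : T -> Prop) :
    P A0 ->
    (forall C : (T -> Prop) -> Prop, (exists A, C A) -> (forall A, C A -> P A) ->
       (forall A B, C A -> C B -> (forall x, A x -> B x) \/ (forall x, B x -> A x)) ->
       P (fun x => exists2 A, C A & A x)) ->
  exists A, [/\ P A, forall x, A0 x -> A x &
    forall B, P B -> (forall x, A x -> B x) -> forall x, B x -> A x].
Proof.
move=> PA0 chain; pose Q A := P A /\ forall x, A0 x -> A x; pose S := sig Q.
pose R (A B : S) := `[< forall x, sval A x -> sval B x >].
have [||C Ctot|[A [PA A0A]] Amax] := @classical_sets.ZL_preorder S (exist Q A0 (conj PA0 (fun _ => id))) R.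
- by move=> A; apply/asboolP.
- by move=> A B D /asboolP AB /asboolP BD; apply/asboolP => x /AB/BD.
- have [[A CA]|nC] := pselect (exists A, C A); last first.
    by exists (exist Q A0 (conj PA0 (fun _ => id))) => B CB; case: nC; exists B.
  pose C' (X : T -> Prop) := exists2 B, C B & sval B = X.
  have PU : P (fun x => exists2 X, C' X & X x).
    apply: chain; first by exists (sval A), A.
      by move=> _ [B _ <-]; case: (svalP B).
    move=> _ _ [B CB <-] [D CD <-].
    by have [/asboolP|/asboolP] := Ctot _ _ CB CD; [left|right].
  have A0U x : A0 x -> exists2 X, C' X & X x.
    by move=> /(proj2 (svalP A)) Ax; exists (sval A) => //; exists A.
  exists (exist Q _ (conj PU A0U)) => B CB; apply/asboolP => x Bx.
  by exists (sval B) => //; exists B.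
exists A; split=> // B PB AB.
have PB' : Q B by split=> // x /A0A/AB.
by have /asboolP := Amax (exist Q B PB') (introT (asboolP _) AB).
Qed.

Section Chevalley.
Variable F : fieldType.

Section Domination.
Variables (R : subringClosed F) (I : F -> Prop).
Hypotheses (I0 : I 0) (ID : forall a b, I a -> I b -> I (a + b)).
Hypotheses (IM : forall a b, a \in R -> I b -> I (a * b)) (IR : forall a, I a -> a \in R).
Hypothesis I1 : ~ I 1.

(** The reduction step of Chevalley's theorem.  When size Q <= size P, multiplying the
    relation Q by x^d, with d the degree of P, expresses (1 - Q`_0) x^d by lower powers
    of x, and this lowers the degree of P. *)
Lemma no_inverse_relations (x : F) (P Q : {poly F}) : x != 0 ->
    (forall i, I P`_i) -> (forall i, I Q`_i) -> P.[x] = 1 -> Q.[x^-1] = 1 -> False.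
Proof.
have [n] := ubnP (size P + size Q)%N; elim: n x P Q => // n IH x P Q.
wlog le_QP : x P Q / (size Q <= size P)%N.
  move=> H; have [le_QP|/ltnW lt_PQ] := leqP (size Q) (size P); first exact: H.
  rewrite addnC => szn x0 IP IQ Px Qx; apply: (H x^-1 Q P) => //.
    by rewrite invr_eq0.
  by rewrite invrK.
rewrite ltnS => szn x0 IP IQ Px Qx.
have [szP|szP] := leqP (size P) 1.
  apply: I1; rewrite -Px (size1_polyC szP) hornerC; exact: IP.
pose d := (size P).-1; have szPd : size P = d.+1 by rewrite prednK // ltnW.
have szQd : (size Q <= d.+1)%N by rewrite -szPd.
pose S := \sum_(i < d) Q`_i.+1 *: 'X^(d - i.+1).
have Sx : S.[x] = (1 - Q`_0) * x ^+ d.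
  rewrite -Qx (horner_coef_wide _ szQd) big_ord_recl expr0 mulr1 addrC addKr.
  rewrite horner_sum mulr_suml; apply: eq_bigr => i _.
  rewrite hornerZ hornerXn -mulrA; congr (_ * _).
  by rewrite exprVn expfB_cond ?(negPf x0) ?ltn_ord //= mulrC.
pose P' := Q`_0 *: 1 + (1 - Q`_0) *: (P - P`_d *: 'X^d) + P`_d *: S.
have P'x : P'.[x] = 1.
  by rewrite /P' !hornerE Px Sx; ring.
have I1Q : 1 - Q`_0 \in R by rewrite rpredB ?rpred1 ?IR.
have IC (b : F) (c : bool) : I b -> I (b * c%:R).
  by case: c => Ib; rewrite ?mulr1 ?mulr0.
have Isum k (f : 'I_k -> F) : (forall i, I (f i)) -> I (\sum_i f i).
  by move=> If; apply: (big_ind I).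
have IP' i : I P'`_i.
  rewrite /P' !(coefD, coefZ, coefN, coef1, coefXn) coef_sum.
  apply: (ID (ID _ _) _); first exact: IC.
    apply: IM => //; apply: ID => //; rewrite -mulrN1 mulrC; apply: IM; last exact: IC.
    by rewrite rpredN rpred1.
  apply: IM; first exact: IR.
  by apply: Isum => j; rewrite coefZ coefXn; apply: IC.
apply: (IH x P' Q) => //; apply: leq_trans szn.
rewrite ltn_add2r szPd ltnS; apply/leq_sizeP => i di.
rewrite /P' !(coefD, coefZ, coefN, coef1, coefXn) coef_sum.
have d0 : (0 < d)%N by rewrite -ltnS -szPd.
rewrite (eqn0Ngt i) (leq_trans d0 di) /= mulr0 add0r.
rewrite big1 ?mulr0 ?addr0 => [|j _]; last first.
  rewrite coefZ coefXn; case: eqP => [E|]; last by rewrite mulr0.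
  by move: di; rewrite E leqNgt ltn_subrL d0.
move: di; rewrite leq_eqVlt => /orP[/eqP->|di]; first by rewrite eqxx mulr1 subrr mulr0.
by rewrite [P`_i]nth_default ?szPd // (gtn_eqF di) mulr0 subr0 mulr0.
Qed.

End Domination.

Definition ideal_span (M R : F -> Prop) (x : F) :=
  exists s : seq (F * F), (forall p, p \in s -> M p.1 /\ R p.2) /\ x = \sum_(p <- s) p.1 * p.2.

Lemma ideal_span0 M R : ideal_span M R 0.
Proof. by exists [::]; rewrite big_nil. Qed.

Lemma ideal_spanD M R x y : ideal_span M R x -> ideal_span M R y -> ideal_span M R (x + y).
Proof.
move=> [s [sP ->]] [s' [s'P ->]]; exists (s ++ s'); rewrite big_cat; split=> // p.
by rewrite mem_cat => /orP[/sP|/s'P].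
Qed.

Lemma ideal_spanM M (R : subringClosed F) a x : a \in R ->
  ideal_span M (fun x => x \in R) x -> ideal_span M (fun x => x \in R) (a * x).
Proof.
move=> aR [s [sP ->]]; exists [seq (p.1, a * p.2) | p <- s]; split.
  by move=> _ /mapP[p /sP[pM pR] ->]; split=> //=; apply: rpredM.
by rewrite big_map mulr_sumr; apply: eq_bigr => p _; rewrite mulrCA.
Qed.

(** A subring R that is maximal among those in which M does not generate the unit
    ideal is a valuation ring: if neither x nor x^-1 is in R, then M generates the
    unit ideal in both R[x] and R[x^-1], against [no_inverse_relations]. *)
Lemma chevalley (B : subringClosed F) (M : F -> Prop) :
    (forall m, M m -> m \in B) -> ~ ideal_span M (fun x => x \in B) 1 ->
  exists W : subringClosed F, [/\ {subset B <= W}, val_subring W &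
    forall m, M m -> m^-1 \in W -> m = 0].
Proof.
move=> MB MB1.
pose isring (R : F -> Prop) := [/\ R 1, forall x y, R x -> R y -> R (x - y) & forall x y, R x -> R y -> R (x * y)].
have [||R [[Rring MR1] BR Rmax]] := @zorn_subset F (fun R => isring R /\ ~ ideal_span M R 1) (fun x => x \in B).
- by split=> //; split; [exact: rpred1|exact: rpredB|exact: rpredM].
- move=> C [A CA] CP Ctot; split.
    split; first by exists A => //; have [[]] := CP _ CA.
      move=> x y [X CX Xx] [Y CY Yy].
      by have [/(_ _ Xx) Yx|/(_ _ Yy) Xy] := Ctot _ _ CX CY; [exists Y|exists X] => //;
         [have [[_ H _] _] := CP _ CY|have [[_ H _] _] := CP _ CX]; apply: H.
    move=> x y [X CX Xx] [Y CY Yy].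
    by have [/(_ _ Xx) Yx|/(_ _ Yy) Xy] := Ctot _ _ CX CY; [exists Y|exists X] => //;
       [have [[_ _ H] _] := CP _ CY|have [[_ _ H] _] := CP _ CX]; apply: H.
  move=> [s [sP s1]].
  have [X CX sX] : exists2 X, C X & forall p, p \in s -> X p.2.
    elim: s sP {s1} => [|p s IH] sP; first by exists A.
    have [|X CX sX] := IH; first by move=> q qs; apply: sP; rewrite inE qs orbT.
    have [_ [Y CY Yp]] := sP _ (mem_head _ _).
    have [XY|YX] := Ctot _ _ CX CY.
      by exists Y => // q; rewrite inE => /orP[/eqP->//|/sX/XY].
    by exists X => // q; rewrite inE => /orP[/eqP->|/sX//]; apply: YX.
  have [_] := CP _ CX; apply; exists s; split=> // p ps; split; last exact: sX.
  by case: (sP _ ps).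
pose R' : {pred F} := fun x => `[< R x >].
have R'P x : reflect (R x) (x \in R') by apply: asboolP.
have R'ring : subring_closed R'.
  case: Rring => R1 RB RM; split; first exact/R'P.
    by move=> x y /R'P xR /R'P yR; apply/R'P/RB.
  by move=> x y /R'P xR /R'P yR; apply/R'P/RM.
pose W : subringClosed F := HB.pack R' (GRing.isSubringClosed.Build F R' R'ring).
have RW : R = (fun x => x \in W) by apply/funext => x; apply/propext; split=> /R'P.
have MW1 : ~ ideal_span M (fun x => x \in W) 1 by rewrite -RW.
have MW m : M m -> m \in W by move=> /MB/BR; rewrite RW.
exists W; split.
- by move=> x /BR; rewrite RW.
- move=> x xW; apply/negPn/negP => VxW.
  have x0 : x != 0 by apply: contraNneq xW => ->; rewrite rpred0.
  have adj y : y \notin W -> exists P : {poly F}, (forall i, ideal_span M (fun x => x \in W) P`_i) /\ P.[y] = 1.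
    move=> yW; pose Wy z := exists2 p : {poly F}, p \is a polyOver W & z = p.[y].
    have WyW z : R z -> Wy z by rewrite RW => zW; exists z%:P; rewrite ?hornerC ?polyOverC.
    have Wyring : isring Wy.
      split; first by apply: WyW; case: Rring.
        by move=> _ _ [p pW ->] [q qW ->]; exists (p - q); rewrite ?hornerE // rpredB.
      by move=> _ _ [p pW ->] [q qW ->]; exists (p * q); rewrite ?hornerE // rpredM.
    have : ideal_span M Wy 1.
      apply: contrapT => Wy1; case/negP: yW.
      have /(_ y) := Rmax Wy (conj Wyring Wy1) WyW; rewrite RW; apply.
      by exists 'X; rewrite ?hornerX ?polyOverX.
    move=> [s [sP ->]]; elim: s sP => [|p s IH] sP.
      by exists 0; rewrite horner0 big_nil; split=> // i; rewrite coef0; apply: ideal_span0.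
    have [|P [PI Py]] := IH; first by move=> q qs; apply: sP; rewrite inE qs orbT.
    have [Mp [q qW pq]] := sP _ (mem_head _ _).
    exists (p.1 *: q + P); rewrite big_cons hornerD hornerZ pq Py; split=> // i.
    rewrite coefD; apply: ideal_spanD => //; exists [:: (p.1, q`_i)].
    rewrite big_seq1 coefZ; split=> // r; rewrite inE => /eqP-> /=; split=> //.
    exact: (polyOverP qW).
  have [P [PI Px]] := adj x xW; have [Q [QI Qx]] := adj _ VxW.
  apply: (@no_inverse_relations W (ideal_span M (fun x => x \in W)) _ _ _ _ _ x P Q) => //.
  + exact: ideal_span0.
  + exact: ideal_spanD.
  + exact: ideal_spanM.
  move=> a [s [sP ->]]; rewrite big_seq rpred_sum // => p /sP[/MW pM pW].
  exact: rpredM.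
move=> m Mm mV; apply: contrapT => /eqP m0; apply: MW1.
exists [:: (m, m^-1)]; rewrite big_seq1 mulfV //; split=> // p.
by rewrite inE => /eqP->.
Qed.

End Chevalley.

(** * Fields at maximal avoiding ideals *)

Lemma integral_ring_in_field (Q : comNzRingType) :
    GRing.integral_domain_axiom Q ->
  exists (L : fieldType) (psi : {rmorphism Q -> L}), forall a, (psi a == 0) = (a == 0).
Proof.
move=> Qint; pose unit : {pred Q} := fun x => `[< exists y, y * x = 1 >].
have /choice[inv invP] (x : Q) : exists y : Q, if x \in unit then y * x = 1 else y = x.
  by rewrite unfold_in; case: asboolP => [[y yx]|_]; [exists y|exists x].
have mulVx : {in unit, left_inverse 1 inv *%R}.
  by move=> x xu; have := invP x; rewrite xu.
have unitPl (x y : Q) : y * x = 1 -> unit x by move=> yx; apply/asboolP; exists y.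
have inv_out : {in [predC unit], inv =1 id}.
  by move=> x; rewrite !inE => /negPf xu; have := invP x; rewrite xu.
pose Qu := GRing.ComNzRing_hasMulInverse.Build Q mulVx unitPl inv_out.
pose Qc : comUnitRingType := HB.pack Q Qu.
pose Qi := GRing.ComUnitRing_isIntegral.Build Qc Qint.
pose D : idomainType := HB.pack Q Qu Qi.
exists {fraction D}, (@FracField.tofrac D : {rmorphism D -> _}) => a.
exact: (@tofrac_eq0 D).
Qed.

Lemma prime_ideal_quotient (A : comNzRingType) (N : {pred A}) :
    idealr_closed N -> prime_idealr_closed N ->
  exists (L : fieldType) (psi : {rmorphism A -> L}), forall a, (psi a == 0) = (a \in N).
Proof.
move=> Nid Nprime.
pose Nz := GRing.isZmodClosed.Build A N (idealr_closedB Nid).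
pose Np := isProperIdeal.Build A N (idealr_closed_nontrivial Nid).
pose Npr := isPrimeIdealrClosed.Build A N Nprime.
pose P : prime_idealr A := HB.pack N Nz Np Npr.
have [L [psi psi0]] := integral_ring_in_field (@Quotient.rquot_IdomainAxiom A P).
pose pi : {rmorphism A -> {ideal_quot P}} := \pi_{ideal_quot P}%qT.
exists L, (psi \o pi) => a; rewrite /= psi0.
rewrite -[in RHS](subr0 a) [RHS](@Quotient.idealrBE A P).
by rewrite -[X in _ = (_ == X)]/(pi 0) rmorph0.
Qed.

(** Take N maximal among the ideals that contain I and avoid S.  If x and y are not in
    N, then N + (x) and N + (y) meet S, hence so does N + (xy): N is prime.  The last
    conclusion records maximality. *)
Lemma field_avoiding (A : comNzRingType) (I S : A -> Prop) :
    is_ideal I -> S 1 -> (forall a b, S a -> S b -> S (a * b)) ->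
    (forall a, I a -> S a -> False) ->
  exists (L : fieldType) (psi : {rmorphism A -> L}),
    [/\ forall a, I a -> psi a = 0, forall a, S a -> psi a != 0 &
      forall a, psi a != 0 -> exists b s, S s /\ psi (b * a) = psi s].
Proof.
move=> Iid S1 SM IS.
have [||N [[[N0 ND NM] NS] IN Nmax]] :=
  @zorn_subset A (fun N => is_ideal N /\ forall a, N a -> S a -> False) I.
- by split.
- move=> C [X CX] CP Ctot; split; last by move=> a [Y /CP[_ H]]; apply: H.
  split; first by exists X => //; have [[]] := CP _ CX.
    move=> x y [Y CY Yx] [Z CZ Zy].
    by have [/(_ _ Yx) Zx|/(_ _ Zy) Yy] := Ctot _ _ CY CZ; [exists Z|exists Y] => //;
       [have [[_ H _] _] := CP _ CZ|have [[_ H _] _] := CP _ CY]; apply: H.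
  move=> x y [Y CY Yx]; exists Y => //; have [[_ _ H] _] := CP _ CY; exact: H.
pose N' : {pred A} := fun x => `[< N x >].
have N'P x : reflect (N x) (x \in N') by apply: asboolP.
have adj a : ~ N a -> exists b s, S s /\ N (s - b * a).
  move=> Na; pose Na' x := exists b, N (x - b * a).
  have Na'id : is_ideal Na'.
    split; first by exists 0; rewrite mul0r subr0.
      move=> x y [b xb] [c yc]; exists (b + c).
      by rewrite mulrDl opprD addrACA; apply: ND.
    by move=> x y [b yb]; exists (x * b); rewrite -mulrA -mulrBr; apply: NM.
  have NNa' x : N x -> Na' x by move=> Nx; exists 0; rewrite mul0r subr0.
  have [[x [b xb] Sx]|nS] := pselect (exists2 x, Na' x & S x); first by exists b, x.
  case: Na; apply: (Nmax Na') => //; last by exists 1; rewrite mul1r subrr.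
  by split=> // x Nx Sx; apply: nS; exists x.
have [|x y|L [psi psiN]] := @prime_ideal_quotient A N'.
- split; [exact/N'P| |].
    by apply/N'P => N1; apply: NS S1.
  by move=> a x y /N'P Nx /N'P Ny; apply/N'P; apply: ND => //; apply: NM.
- move=> /N'P Nxy; apply/orP; apply: contrapT => /not_orP[/negP/N'P Nx /negP/N'P Ny].
  have [b [s [Ss Ns]]] := adj _ Nx; have [c [t [St Nt]]] := adj _ Ny.
  apply: (NS (s * t)); last exact: SM.
  have -> : s * t = t * (s - b * x) + (b * x * (t - c * y) + b * c * (x * y)) by ring.
  exact: (ND _ _ (NM _ _ Ns) (ND _ _ (NM _ _ Nt) (NM _ _ Nxy))).
exists L, psi; split.
- by move=> a /IN Na; apply/eqP; rewrite psiN; apply/N'P.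
- by move=> a Sa; rewrite psiN; apply/N'P => Na; apply: NS Sa.
move=> a; rewrite psiN => /N'P/adj[b [s [Ss Ns]]]; exists b, s; split=> //.
by apply/esym/eqP; rewrite -subr_eq0 -rmorphB psiN; apply/N'P.
Qed.

(** * The Nullstellensatz over a valuation ring *)

(** The values of the terms built from the operations, of which there are countably
    many. *)
Lemma countable_hull (T : Type) (Ix : countType) (ops : Ix -> seq T -> T) :
  exists (P : {pred T}) (enum : nat -> option T),
    (forall x, x \in P -> exists n, enum n = Some x) /\
    (forall i s, all (mem P) s -> ops i s \in P).
Proof.
pose fix eval (t : GenTree.tree unit) : option T :=
  match t with
  | GenTree.Leaf _ => None
  | GenTree.Node n ts => if choice.unpickle n is Some i then Some (ops i (pmap eval ts)) else None
  end.
exists (fun x => `[< exists t, eval t = Some x >]), (fun n => obind eval (choice.unpickle n)); split.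
  by move=> x /asboolP[t tx]; exists (choice.pickle t); rewrite choice.pickleK.
move=> i s sP; have [ts <-] : exists ts, pmap eval ts = s.
  elim: s sP => [|x s IH] /=; first by exists [::].
  by case/andP=> /asboolP[t tx] /IH[ts <-]; exists (t :: ts); rewrite /= tx.
by apply/asboolP; exists (GenTree.Node (choice.pickle i) ts); rewrite /= choice.pickleK.
Qed.

Section MevalTheory.
Variables (K S : comNzRingType) (f : {rmorphism K -> S}) (J : finType) (x : J -> S).
Implicit Types (r : seq (K * (J -> nat))).

Definition meval_scale (c : K) r := [seq (c * p.1, p.2) | p <- r].
Definition meval_mul r s : seq (K * (J -> nat)) :=
  [seq (p.1 * q.1, fun j => (p.2 j + q.2 j)%N) | p <- r, q <- s].
Definition meval_const (c : K) : seq (K * (J -> nat)) := [:: (c, fun=> 0%N)].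
Definition meval_var (j : J) : seq (K * (J -> nat)) := [:: (1, fun i => (i == j) : nat)].

Lemma meval_cat r s : meval f x (r ++ s) = meval f x r + meval f x s.
Proof. exact: big_cat. Qed.

Lemma meval_scaleE c r : meval f x (meval_scale c r) = f c * meval f x r.
Proof.
by rewrite /meval big_map mulr_sumr; apply: eq_bigr => p _; rewrite rmorphM mulrA.
Qed.

Lemma meval_mulE r s : meval f x (meval_mul r s) = meval f x r * meval f x s.
Proof.
rewrite /meval big_allpairs_dep mulr_suml; apply: eq_bigr => p _.
rewrite mulr_sumr; apply: eq_bigr => q _; rewrite /= rmorphM mulrACA; congr (_ * _).
by rewrite -big_split; apply: eq_bigr => j _; rewrite exprD.
Qed.

Lemma meval_constE c : meval f x (meval_const c) = f c.
Proof. by rewrite /meval big_seq1 big1 ?mulr1 // => j _; rewrite expr0. Qed.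

Lemma meval_varE j : meval f x (meval_var j) = x j.
Proof.
rewrite /meval big_seq1 rmorph1 mul1r (bigD1 j) //= eqxx expr1 big1 ?mulr1 //.
by move=> i /negPf ij; rewrite ij expr0.
Qed.

Lemma meval_comp (S' : comNzRingType) (g : {rmorphism S -> S'}) r :
  meval (g \o f) (g \o x) r = g (meval f x r).
Proof.
rewrite rmorph_sum; apply: eq_bigr => p _; rewrite rmorphM rmorph_prod.
by congr (_ * _); apply: eq_bigr => j _; rewrite rmorphXn.
Qed.

End MevalTheory.

Section FieldCore.
Variables (K : closedFieldType) (V : subringClosed K) (J : finType).
Hypothesis Vval : val_subring V.

Definition infinitesimal (r : seq (K * (J -> nat))) := all (fun p => nonunit V p.1) r.

Lemma infinitesimal_cat r s : infinitesimal (r ++ s) = infinitesimal r && infinitesimal s.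
Proof. exact: all_cat. Qed.

Lemma infinitesimal_scale c r : c \in V -> infinitesimal r -> infinitesimal (meval_scale c r).
Proof. by move=> cV; rewrite /infinitesimal all_map; apply: sub_all => p; apply: nonunitM. Qed.

(** The nonunits form an ideal of V. *)
Lemma meval_infinitesimal (z : J -> K) r : (forall j, z j \in V) -> infinitesimal r ->
  nonunit V (meval idfun z r).
Proof.
move=> zV; elim: r => [|p r IH] /=; first by rewrite /meval big_nil /nonunit eqxx.
case/andP=> pN /IH rN; rewrite /meval big_cons; apply: (nonunitD Vval) => //.
rewrite mulrC; apply: (nonunitM) => //.
by rewrite rpred_prod // => j _; rewrite rpredX.
Qed.

(** The second hypothesis provides certificates, which say that x j - kappa z becomes
    invertible up to 1 + m O[x].  A zero z over a small enough field of all relations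
    of x must then be x itself. *)
Lemma coordinates_in_base (L : fieldType) (kappa : {rmorphism K -> L}) (x : J -> L) :
    (forall mu, infinitesimal mu -> meval kappa x mu != 1) ->
    (forall j z, x j != kappa z -> exists r mu, infinitesimal mu /\
       meval kappa x r * (x j - kappa z) = 1 + meval kappa x mu) ->
  exists z : J -> K, forall j, z j \in V /\ x j = kappa (z j).
Proof.
move=> mu1 certif.
have {certif} cert_ex (jz : J * K) : exists c : bool -> seq (K * (J -> nat)),
    x jz.1 != kappa jz.2 -> infinitesimal (c false) /\
    meval kappa x (c true) * (x jz.1 - kappa jz.2) = 1 + meval kappa x (c false).
  have [_|/certif[r [mu rmu]]] := eqVneq (x jz.1) (kappa jz.2); first by exists (fun=> [::]).
  by exists (fun b => if b then r else mu).
have {cert_ex} [cert certP] := choice cert_ex.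
have root_ex (c : seq K) : exists z, (0 < size c)%N ->
    z ^+ size c = \sum_(i < size c) c`_i * z ^+ i.
  have [->|c0] := posnP (size c); first by exists 0.
  by have [z zP] := solve_monicpoly (fun i => c`_i) c0; exists z.
have {root_ex} [rt rtP] := choice root_ex.
have kinv_ex (y : L) : exists c, forall c', y = kappa c' -> c = c'.
  have [[c ->]|nc] := pselect (exists c, y = kappa c); last first.
    by exists 0 => c' yc; case: nc; exists c'.
  by exists c => c' /fmorph_inj.
have {kinv_ex} [kinv kinvP] := choice kinv_ex.
have kinvK : cancel kappa kinv by move=> c; apply: kinvP.
(* The operations: field operations, roots of monic equations over K, the x j, and
   the coefficients of the certificates. *)
pose Ix := (nat + J + J * bool * nat)%type.
pose ops (i : Ix) (s : seq L) : L :=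
  match i with
  | inl (inl 0) => 1
  | inl (inl 1) => s`_0 - s`_1
  | inl (inl 2) => s`_0 / s`_1
  | inl (inl _) => kappa (rt (map kinv s))
  | inl (inr j) => x j
  | inr (j, b, k) => kappa (nth 0 [seq p.1 | p <- cert (j, kinv s`_0) b] k)
  end.
have [P [enumP [enumPP Pop]]] := countable_hull ops.
have Pdiv : divring_closed P.
  split; first exact: (Pop (inl (inl 0%N)) [::]).
    by move=> a b aP bP; apply: (Pop (inl (inl 1%N)) [:: a; b]); rewrite /= aP bP.
  by move=> a b aP bP; apply: (Pop (inl (inl 2%N)) [:: a; b]); rewrite /= aP bP.
have xP j : x j \in P by apply: (Pop (inl (inr j)) [::]).
pose PK : {pred K} := [pred c | kappa c \in P].
have PKdiv : divring_closed PK.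
  case: Pdiv => P1 PB PD; split; rewrite ?inE /= ?rmorph1 // => a b; rewrite !inE /= => aP bP.
    by rewrite rmorphB; apply: PB.
  by rewrite fmorph_div; apply: PD.
have PKroot n (c : nat -> K) : (0 < n)%N -> (forall i, c i \in PK) ->
    exists2 z, z \in PK & z ^+ n = \sum_(i < n) c i * z ^+ i.
  move=> n0 cP; exists (rt (mkseq c n)).
    have := Pop (inl (inl 3)) [seq kappa (c i) | i <- iota 0 n].
    rewrite /= -map_comp (eq_map (g := c)); last by move=> i /=; rewrite kinvK.
    by apply; rewrite all_map; apply/allP => i _; apply: cP.
  have := rtP (mkseq c n); rewrite size_mkseq => ->//.
  by apply: eq_bigr => i _; rewrite nth_mkseq.
have [K0 [i0 i0P]] := closed_subfield PKdiv PKroot.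
(* The hull L0 is a countable field, K0 its intersection with K; Om is an algebraic
   closure of L0. *)
pose L0 := subfield_type Pdiv.
have /choice[code codeP] (l : L0) : exists n, enumP n = Some (val l).
  by apply: enumPP; apply: (valP l).
have codeK : pcancel code (fun n => obind insub (enumP n) : option L0).
  by move=> l; rewrite codeP /= valK.
pose L0count := isCountable.Build L0 codeK.
pose L0c : countFieldType := HB.pack L0 L0count.
have [Om [jj _]] := countable_algebraic_closure L0c.
pose io : {rmorphism L0c -> L} := (\val : {rmorphism L0 -> L}).
have io_inj : injective io by apply: fmorph_inj.
have /choice[lift liftP] (e : K0) : exists l : L0c, io l = kappa (i0 e).
  have eP : kappa (i0 e) \in P by apply/i0P; exists e.
  by exists (Subfield eP : L0).
have lift_add : zmod_morphism lift.
  by move=> a b; apply: io_inj; rewrite rmorphB !liftP !rmorphB.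
have lift_mul : monoid_morphism lift.
  split; first by apply: io_inj; rewrite liftP !rmorph1.
  by move=> a b; apply: io_inj; rewrite rmorphM !liftP !rmorphM.
pose liftM : {rmorphism K0 -> L0c} := HB.pack lift
  (GRing.isZmodMorphism.Build K0 L0c lift lift_add)
  (GRing.isMonoidMorphism.Build K0 L0c lift lift_mul).
pose iota : {rmorphism K0 -> Om} := jj \o liftM.
have /choice[xl xlP] j : exists l : L0c, io l = x j by exists (Subfield (xP j) : L0).
pose xO := jj \o xl.
pose up (r : seq (K0 * (J -> nat))) := [seq (i0 p.1, p.2) | p <- r].
have transport r : meval iota xO r = jj (meval liftM xl r) /\
    io (meval liftM xl r) = meval kappa x (up r).
  split; first by rewrite -meval_comp.
  rewrite -meval_comp /meval big_map; apply: eq_bigr => p _.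
  congr (_ * _); first exact: liftP.
  by apply: eq_bigr => j _; congr (_ ^+ _); apply: xlP.
have transport_eq r c : meval kappa x (up r) = c%:R -> meval iota xO r = c%:R.
  have [-> ioE] := transport r; rewrite -ioE -(rmorph_nat io) => /io_inj->.
  by rewrite rmorph_nat.
have transport_eq1 r : meval iota xO r = 1 -> meval kappa x (up r) = 1.
  have [-> <-] := transport r; rewrite -(rmorph1 jj) => /fmorph_inj->.
  by rewrite rmorph1.
(* B is the subring of Om generated by x over the integers V0 of K0, and M the
   maximal ideal of V0; the first hypothesis says that M B is proper. *)
pose V0 := preim_subring V i0.
pose Bp : {pred Om} := fun y => `[< exists r, all (fun p : K0 * (J -> nat) => p.1 \in V0) r /\ y = meval iota xO r >].
have Bring : subring_closed Bp.
  split.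
  - apply/asboolP; exists (meval_const J 1); rewrite meval_constE rmorph1 /= andbT; split=> //.
    exact: rpred1.
  - move=> _ _ /asboolP[r [rV ->]] /asboolP[s [sV ->]]; apply/asboolP.
    exists (r ++ meval_scale (-1) s); rewrite meval_cat meval_scaleE rmorphN1 mulN1r; split=> //.
    rewrite all_cat rV all_map; apply: sub_all sV => p pV /=.
    by rewrite mulN1r rpredN.
  - move=> _ _ /asboolP[r [rV ->]] /asboolP[s [sV ->]]; apply/asboolP.
    exists (meval_mul r s); rewrite meval_mulE; split=> //.
    elim: r rV => //= p r IH /andP[pV rV]; rewrite all_cat IH // andbT all_map.
    by apply: sub_all sV => q qV /=; rewrite rpredM.
pose B : subringClosed Om := HB.pack Bp (GRing.isSubringClosed.Build Om Bp Bring).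
pose M m := exists c : K0, nonunit V (i0 c) /\ m = iota c.
have [||W [BW Wval MW]] := @chevalley Om B M.
- move=> _ [c [cN ->]]; apply/asboolP; exists (meval_const J c).
  rewrite meval_constE /= andbT; split=> //; apply: (nonunit_V Vval cN).
- move=> [s [sP s1]].
  suff [mu [muN muE]] : exists mu, infinitesimal (up mu) /\ meval iota xO mu = 1.
    by have /eqP[] := mu1 _ muN; apply: transport_eq1.
  rewrite s1; elim: s sP {s1} => [|p s IH] sP.
    by exists [::]; rewrite /meval !big_nil.
  have [|mu [muN muE]] := IH; first by move=> q qs; apply: sP; rewrite inE qs orbT.
  have [[c [cN pc]] /asboolP[r [rV pr]]] := sP _ (mem_head _ _).
  exists (meval_scale c r ++ mu); rewrite meval_cat meval_scaleE big_cons muE pc pr.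
  split=> //; rewrite /up map_cat infinitesimal_cat -/(up mu) muN andbT.
  rewrite /infinitesimal !all_map; apply: sub_all rV => q qV /=.
  by rewrite rmorphM mulrC; apply: nonunitM.
have iotaW (c : K0) : iota c \in W -> i0 c \in V.
  move=> cW; apply/negPn/negP => cV.
  have c0 : c != 0 by apply: contraNneq cV => ->; rewrite rmorph0 rpred0.
  have /MW : M (iota c^-1).
    by exists c^-1; split=> //; rewrite fmorphV /nonunit invrK cV orbT.
  rewrite fmorphV invrK => /(_ cW)/eqP.
  by rewrite invr_eq0 fmorph_eq0 (negPf c0).
have xW j : xO j \in W.
  apply: BW; apply/asboolP; exists (meval_var K0 j); rewrite meval_varE /= andbT; split=> //.
  exact: rpred1.
have [z [zW zr]] := descend_point Wval iota xW.
have zV j : i0 (z j) \in V by apply: iotaW.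
exists (fun j => i0 (z j)) => j; split=> //.
(* Otherwise R, which expresses the certificate for z j, is a relation over K0, and
   its value at z says that 1 is a nonunit. *)
apply/eqP/negPn/negP => xz; have [muN rmu] := certP (j, i0 (z j)) xz.
have lift_cert b : exists r, up r = cert (j, i0 (z j)) b.
  have : forall k, exists e, i0 e = nth 0 [seq p.1 | p <- cert (j, i0 (z j)) b] k.
    move=> k; apply/i0P; rewrite inE /=.
    have := Pop (inr (j, b, k)) [:: kappa (i0 (z j))].
    by rewrite /= kinvK; apply; rewrite andbT; apply/i0P; exists (z j).
  elim: (cert _ _) => [|p s IH] sP; first by exists [::].
  have [r <-] := IH (fun k => sP k.+1); have [e ep] := sP 0%N.
  by exists ((e, p.2) :: r); rewrite /= ep; case: (p).
have [[r rE] [mu muE]] := (lift_cert true, lift_cert false).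
pose R := meval_mul r (meval_var K0 j ++ meval_const J (- z j)) ++ 
   meval_scale (-1) (meval_const J 1 ++ mu).
have RE (S : comNzRingType) (f : {rmorphism K0 -> S}) (w : J -> S) :
    meval f w R = meval f w r * (w j - f (z j)) - (1 + meval f w mu).
  rewrite /R meval_cat meval_mulE meval_scaleE !meval_cat !meval_constE meval_varE.
  by rewrite !rmorphN1 rmorphN rmorph1 mulN1r.
have upE q : meval kappa x (up q) = meval (kappa \o i0) x q by rewrite /meval big_map.
have : meval idfun z R = 0.
  apply: zr; apply: (transport_eq _ 0%N); rewrite upE RE -!upE rE muE.
  by apply/eqP; rewrite subr_eq0 rmu.
rewrite RE subrr mulr0 sub0r => /eqP; rewrite oppr_eq0 addr_eq0 => /eqP muz.
have := meval_infinitesimal zV muN.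
have -> : meval idfun (fun j => i0 (z j)) (cert (j, i0 (z j)) false) = i0 (meval idfun z mu).
  by rewrite -muE -meval_comp /meval big_map.
rewrite -[meval _ _ _]opprK -muz rmorphN rmorph1.
by rewrite /nonunit oppr_eq0 oner_eq0 invrN invr1 rpredN rpred1.
Qed.

End FieldCore.

Section Core.
Variables (K : closedFieldType) (V : subringClosed K) (J : finType).
Hypothesis Vval : val_subring V.

(** The ideal I avoids the multiplicative set 1 + m O[x].  In the field at a maximal
    ideal avoiding it, the coordinates x j come from O. *)
Theorem valuative_nullstellensatz (A : comNzRingType) (kappa : {rmorphism K -> A})
    (x : J -> A) (I : A -> Prop) :
    (forall a, exists r, a = meval kappa x r) -> is_ideal I ->
    (forall mu, infinitesimal V mu -> ~ I (1 + meval kappa x mu)) ->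
  exists z : J -> K, (forall j, z j \in V) /\
    forall r, I (meval kappa x r) -> meval idfun z r = 0.
Proof.
move=> gen Iid Imu.
pose S a := exists2 mu, infinitesimal V mu & a = 1 + meval kappa x mu.
have [|||L [psi [psiI psiS psiC]]] := @field_avoiding A I S Iid.
- by exists [::]; rewrite // /meval big_nil addr0.
- move=> _ _ [mu muN ->] [nu nuN ->]; exists (mu ++ nu ++ meval_mul mu nu).
    rewrite !infinitesimal_cat muN nuN /=; elim: mu muN => //= p mu IH /andP[pN muN].
    rewrite [meval_mul _ _]/(_ ++ meval_mul mu nu) infinitesimal_cat IH // andbT.
    rewrite /infinitesimal all_map; apply: sub_all nuN => q qN /=.
    by apply: nonunitM => //; apply: nonunit_V.
  by rewrite !meval_cat meval_mulE; ring.
- by move=> a Ia [mu muN aE]; apply: (Imu mu muN); rewrite -aE.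
have [||z zP] := @coordinates_in_base K V J Vval L (psi \o kappa) (psi \o x).
- move=> mu muN; rewrite meval_comp; apply/eqP => mu1.
  have /eqP[] : psi (1 + meval kappa x (meval_scale (-1) mu)) != 0.
    apply: psiS; exists (meval_scale (-1) mu) => //.
    by apply: infinitesimal_scale => //; rewrite rpredN rpred1.
  by rewrite meval_scaleE rmorphD rmorphM mu1 rmorph1 !rmorphN1 mulr1 subrr.
- move=> j z xz; have [|b [s [[mu muN ->] bs]]] := psiC (x j - kappa z).
    by rewrite rmorphB subr_eq0.
  have [r bE] := gen b; exists r, mu; split=> //.
  by rewrite !meval_comp -bE -rmorphB -rmorphM bs rmorphD rmorph1.
exists z; split=> [j|r Ir]; first by case: (zP j).
apply: (fmorph_inj (psi \o kappa)); rewrite rmorph0 -[RHS](psiI _ Ir) -meval_comp.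
rewrite -meval_comp; apply: eq_bigr => p _; congr (_ * _).
by apply: eq_bigr => j _; congr (_ ^+ _); apply/esym/(zP j).2.
Qed.

End Core.

(** * Valuations, residues and cross-sections *)

Section OrderedValues.
Variable G : orderedZmodType.
Implicit Types (a b c : option G).

Lemma vle_refl a : vle a a. Proof. by case: a => /=. Qed.

Lemma vle_total a b : vle a b || vle b a.
Proof. by case: a b => [a|] [b|] //=; apply: ozmod_le_total. Qed.

Lemma vle_anti a b : vle a b -> vle b a -> a = b.
Proof. by case: a b => [a|] [b|] //= ab ba; congr Some; apply/le_anti/andP. Qed.

Lemma vlt_vle a b : vlt a b -> vle a b.
Proof. by rewrite /vlt; have /orP[->//|->] := vle_total a b. Qed.

Lemma vlt_vle_trans a b c : vlt a b -> vle b c -> vlt a c.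
Proof. by move=> ab bc; apply: contra ab; apply: vle_trans. Qed.

Lemma vle_neq_vlt a b : vle a b -> a <> b -> vlt a b.
Proof. by move=> ab ne; apply/negP => ba; apply: ne; apply: vle_anti. Qed.

Lemma vaddC a b : vadd a b = vadd b a.
Proof. by case: a b => [a|] [b|] //=; rewrite addrC. Qed.

Lemma vadd0 a : vadd a (Some 0) = a.
Proof. by case: a => [a|] //=; rewrite addr0. Qed.

Lemma vle_add2r (x : G) a b : vle (vadd a (Some x)) (vadd b (Some x)) = vle a b.
Proof.
case: a b => [a|] [b|] //=; rewrite ![_ + x]addrC.
by apply/idP/idP => [/(ozmod_lerD2l _ _ (- x))|/(ozmod_lerD2l _ _ x)//]; rewrite !addKr.
Qed.

Lemma vlt_add2r (x : G) a b : vlt (vadd a (Some x)) (vadd b (Some x)) = vlt a b.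
Proof. by rewrite /vlt vle_add2r. Qed.

End OrderedValues.

Section ValuationTheory.
Local Open Scope quotient_scope.
Variables (K : fieldType) (G : orderedZmodType) (v : valuation K G).

Lemma valuation_val_subring : val_subring (val_ring v).
Proof.
move=> x; rewrite !inE => xV; have x0 : x != 0.
  by apply: contraNneq xV => ->; rewrite valuation0.
have := valuationV v x0; case E: (v x) xV => [a|//] /= aV.
case: (v x^-1) => [b|//] /= [] ba; have : a <= 0.
  by have /orP[] := ozmod_le_total 0 a; rewrite // (negPf aV).
by move/(ozmod_lerD2l _ _ b); rewrite ba addr0.
Qed.

Lemma vlt_valuationD x y c : vlt c (v x) -> vlt c (v y) -> vlt c (v (x + y)).
Proof.
move=> cx cy; apply: vlt_vle_trans (valuationD v x y).
by rewrite /vmin; case: ifP.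
Qed.

Lemma vlt_valuation_sum (I : eqType) (r : seq I) (F : I -> K) (c : G) :
  (forall i, i \in r -> vlt (Some c) (v (F i))) -> vlt (Some c) (v (\sum_(i <- r) F i)).
Proof.
rewrite big_seq => H; elim/big_ind: _ => // [|x y]; first by rewrite valuation0.
exact: vlt_valuationD.
Qed.

Lemma valuationX x a k : v x = Some a -> v (x ^+ k) = Some (a *+ k).
Proof.
move=> xa; elim: k => [|k IH]; first by rewrite expr0 valuation1.
by rewrite exprS valuationM xa IH /= mulrS.
Qed.

Lemma valuation_some x : x != 0 -> exists a, v x = Some a.
Proof.
by case E: (v x) => [a|]; [exists a|move/valuation_eq0: E => ->; rewrite eqxx].
Qed.

Lemma valuationVE x a : v x = Some a -> v x^-1 = Some (- a).
Proof.
move=> xa; have x0 : x != 0 by apply/eqP => /(valuation_eq0 v); rewrite xa.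
have := valuationV v x0; rewrite xa; case: (v x^-1) => [b|] //= [] /eqP.
by rewrite addr_eq0 => /eqP->.
Qed.

Lemma valuationXz x a (k : int) : v x = Some a -> v (x ^ k) = Some (a *~ k).
Proof.
move=> xa; case: k => k; first exact: valuationX.
by rewrite NegzE -exprnN mulrNz; apply/valuationVE/valuationX.
Qed.

Lemma valuation_prod (I : finType) (F : I -> K) (a : I -> G) :
  (forall i, v (F i) = Some (a i)) -> v (\prod_i F i) = Some (\sum_i a i).
Proof.
move=> Fa; elim/big_rec2: _ => [|i x y _ E]; first exact: valuation1.
by rewrite valuationM E Fa.
Qed.

Lemma residue_pi (x : K) (xV : x \in val_ring v) :
  residue v x = \pi_(residue_field v) (ValRing xV).
Proof. by congr (\pi_(residue_field v) _); apply: val_inj; rewrite insubdK. Qed.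

Lemma residue0 : residue v 0 = 0.
Proof.
rewrite (residue_pi (rpred0 (val_ring v))) -[RHS](rmorph0 (\pi_(residue_field v))).
by congr (\pi_(residue_field v) _); apply: val_inj; rewrite rmorph0.
Qed.

Lemma residueD x y : x \in val_ring v -> y \in val_ring v ->
  residue v (x + y) = residue v x + residue v y.
Proof.
move=> xV yV; rewrite (residue_pi xV) (residue_pi yV) (residue_pi (rpredD xV yV)) -rmorphD.
by congr (\pi_(residue_field v) _); apply: val_inj; rewrite rmorphD.
Qed.

Lemma residueM x y : x \in val_ring v -> y \in val_ring v ->
  residue v (x * y) = residue v x * residue v y.
Proof.
move=> xV yV; rewrite (residue_pi xV) (residue_pi yV) (residue_pi (rpredM xV yV)) -rmorphM.
by congr (\pi_(residue_field v) _); apply: val_inj; rewrite rmorphM.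
Qed.

Lemma residue_eq0 x : x \in val_ring v -> (residue v x == 0) = vlt (Some 0) (v x).
Proof.
move=> xV; rewrite (residue_pi xV) -[0 in LHS](rmorph0 (\pi_(residue_field v))).
by rewrite -Quotient.idealrBE subr0 val_maxE.
Qed.

Lemma residue_surj (q : residue_field v) : exists2 x, x \in val_ring v & residue v x = q.
Proof.
exists (val (repr q)); first exact: (valP (repr q)).
rewrite (residue_pi (valP (repr q))) -[RHS]reprK.
by congr (\pi_(residue_field v) _); apply: val_inj.
Qed.

End ValuationTheory.

Lemma nonunitE (K : closedFieldType) (G : orderedZmodType) (v : valuation K G) x :
  nonunit (val_ring v : subringClosed K) x = vlt (Some 0) (v x).
Proof.
rewrite /nonunit; have [->|x0] := eqVneq x 0; first by rewrite valuation0.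
rewrite inE /=; have := valuationV v x0; rewrite /vlt.
case: (v x^-1) (v x) => [b|] [a|] //= [] ba; congr negb.
have -> : b = - a by apply/eqP; rewrite -addr_eq0 ba.
apply/idP/idP => [/(ozmod_lerD2l _ _ a)|/ozmod_oppr_ge0//].
by rewrite addr0 subrr.
Qed.

Section CrossSection.
Variables (K : fieldType) (G : orderedZmodType) (v : valuation K G) (s : cross_section v).

Lemma cross_section_neq0 a : s a != 0.
Proof. by apply/eqP => /(valuation_eq0 v); rewrite cross_sectionK. Qed.

Lemma cross_section0 : s 0 = 1.
Proof.
by apply: (mulfI (cross_section_neq0 0)); rewrite -cross_sectionD addr0 mulr1.
Qed.

Lemma cross_sectionN a : s (- a) = (s a)^-1.
Proof.
apply: (mulfI (cross_section_neq0 a)); rewrite -cross_sectionD subrr cross_section0.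
by rewrite mulfV // cross_section_neq0.
Qed.

Lemma cross_sectionMz a (k : int) : s (a *~ k) = s a ^ k.
Proof.
have X (m : nat) : s (a *+ m) = s a ^+ m.
  elim: m => [|m IH]; first exact: cross_section0.
  by rewrite mulrS exprS cross_sectionD IH.
case: k => k; first exact: X.
by rewrite NegzE mulrNz -exprnN cross_sectionN; congr (_^-1); apply: X.
Qed.

Lemma cross_section_sum (I : finType) (a : I -> G) : s (\sum_i a i) = \prod_i s (a i).
Proof. exact: (big_morph s (cross_sectionD s) cross_section0). Qed.

End CrossSection.

(** * Laurent polynomials *)

Section LaurentMonomials.
Variables (n : nat) (R : comNzRingType).
Implicit Types (u w : (int ^ n)%type) (f g : {laurent R[n]}).

Lemma laurentUM u w (a b : R) :
  (mkmalgU u a : {laurent R[n]}) * mkmalgU w b = mkmalgU (u + w) (a * b).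
Proof. exact: laurent_mulUU. Qed.

Lemma mcoeff_sum (I : Type) (r : seq I) (P : pred I) (F : I -> {laurent R[n]}) w :
  (\sum_(i <- r | P i) F i)@_w = \sum_(i <- r | P i) (F i)@_w.
Proof. exact: (raddf_sum (mcoeff w)). Qed.

Lemma mcoeff_sumU (r : seq (int ^ n)%type) (P : pred (int ^ n)%type)
    (F : (int ^ n)%type -> R) w : uniq r ->
  (\sum_(u <- r | P u) (mkmalgU u (F u) : {laurent R[n]}))@_w =
  if (w \in r) && P w then F w else 0.
Proof.
move=> r_uniq; rewrite mcoeff_sum big_mkcond /=.
rewrite (eq_bigr (fun u => if (u == w) && P u then F w else 0)).
  case: ifPn => [/andP[wr Pw]|nw].
    by rewrite (bigD1_seq w) //= eqxx Pw big1 ?addr0 // => u /negPf->.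
  rewrite big_seq big1 // => u ur; case: eqP => //= uw.
  by move: nw; rewrite -uw ur /= => /negPf->.
move=> u _; rewrite mcoeffU; case: eqP => [->|_] /=; first by case: ifP; rewrite // mulr1n.
by rewrite mulr0n; case: ifP.
Qed.

Lemma mcoeff_mulU u (a : R) f w :
  ((mkmalgU u a : {laurent R[n]}) * f)@_w = a * f@_(w - u).
Proof.
rewrite [f in LHS]monalgE mulr_sumr mcoeff_sum.
under eq_bigr do rewrite laurentUM mcoeffU.
have [wf|wf] := boolP (w - u \in msupp f).
  rewrite (bigD1_seq (w - u)) ?fset_uniq //= (addrC u) subrK eqxx mulr1n big1 ?addr0 //.
  move=> t tw; case: eqP => [tE|]; last by rewrite mulr0n.
  by move: tw; rewrite -tE addrAC subrr add0r eqxx.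
rewrite (mcoeff_outdom wf) mulr0 big_seq big1 // => t tf.
case: eqP => [tE|]; last by rewrite mulr0n.
by move: wf; rewrite -tE addrAC subrr add0r tf.
Qed.

Definition laurentC (c : R) : {laurent R[n]} := mkmalgU 0 c.

Lemma laurentC_is_zmod_morphism : zmod_morphism laurentC.
Proof. by move=> a b; apply: monalgUB. Qed.

Lemma laurentC_is_monoid_morphism : monoid_morphism laurentC.
Proof. by split=> // a b; rewrite /laurentC laurentUM addr0. Qed.

HB.instance Definition _ := GRing.isZmodMorphism.Build R {laurent R[n]} laurentC
  laurentC_is_zmod_morphism.
HB.instance Definition _ := GRing.isMonoidMorphism.Build R {laurent R[n]} laurentC
  laurentC_is_monoid_morphism.

End LaurentMonomials.

Section Pairing.
Variables (G : orderedZmodType) (n : nat) (gamma : (G ^ n)%type).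

Lemma pairingD u w : pairing (u + w) gamma = pairing u gamma + pairing w gamma.
Proof. by rewrite -big_split; apply: eq_bigr => i _; rewrite ffunE mulrzDr. Qed.

Lemma pairing0 : pairing 0 gamma = 0.
Proof. by rewrite /pairing big1 // => i _; rewrite ffunE mulr0z. Qed.

End Pairing.

Section Exponents.
Variable n : nat.

(** The exponent e_i for (i, true) and -e_i for (i, false): the variables and their
    inverses are treated as 2 n independent coordinates. *)
Definition unit_exp (j : 'I_n * bool) : (int ^ n)%type :=
  [ffun i => if i == j.1 then (if j.2 then 1 else -1) else 0].

Definition split_exp (u : (int ^ n)%type) (j : 'I_n * bool) : nat :=
  match u j.1 with
  | Posz k => if j.2 then k else 0
  | Negz k => if j.2 then 0 else k.+1
  end.

Lemma big_pair_bool (S : Type) (idx : S) (op : Monoid.com_law idx) (F : 'I_n * bool -> S) :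
  \big[op/idx]_j F j = \big[op/idx]_(i < n) op (F (i, true)) (F (i, false)).
Proof.
rewrite (eq_bigr (fun j => F (j.1, j.2))); last by case.
by rewrite -(pair_bigA _ (fun i b => F (i, b))) /=; apply: eq_bigr => i _; rewrite big_bool.
Qed.

Lemma split_expE u : \sum_j unit_exp j *+ split_exp u j = u.
Proof.
apply/ffunP => i; rewrite big_pair_bool sum_ffunE (bigD1 i) //= big1 ?addr0.
  rewrite !ffunE /= !ffunMnE !ffunE eqxx /split_exp /=.
  case: (u i) => k; rewrite mulr0n ?addr0 ?add0r; first by rewrite natz.
  by rewrite mulNrn natz NegzE.
move=> j /negPf ji; rewrite !ffunE /= !ffunMnE !ffunE /= eq_sym ji.
by rewrite !mul0rn addr0.
Qed.

Lemma prod_split_exp (S : fieldType) (z : 'I_n * bool -> S) u :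
    (forall i, z (i, true) * z (i, false) = 1) ->
  \prod_j z j ^+ split_exp u j = \prod_i z (i, true) ^ u i.
Proof.
move=> zz; rewrite big_pair_bool; apply: eq_bigr => i _.
have z0 : z (i, true) != 0.
  by apply/eqP => z0; move/eqP: (zz i); rewrite z0 mul0r eq_sym oner_eq0.
have -> : z (i, false) = (z (i, true))^-1 by apply: (mulfI z0); rewrite zz mulfV.
rewrite /split_exp /=; case: (u i) => k; first by rewrite expr0 mulr1.
by rewrite expr0 mul1r exprVn NegzE -exprnN.
Qed.

End Exponents.

(** * Tropical polynomials and initial forms *)

Section TropicalTheory.
Variables (K : fieldType) (G : orderedZmodType) (v : valuation K G) (n : nat).
Variable gamma : (G ^ n)%type.
Implicit Types (f : {laurent K[n]}) (u w : (int ^ n)%type).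

Lemma trop_term_out f u : u \notin msupp f -> trop_term v f gamma u = None.
Proof. by move=> uf; rewrite /trop_term (mcoeff_outdom uf) valuation0. Qed.

Lemma trop_term_in f u : u \in msupp f -> exists a, trop_term v f gamma u = Some a.
Proof.
rewrite -mcoeff_neq0 => /(valuation_some v)[a fa].
by exists (a + pairing u gamma); rewrite /trop_term fa.
Qed.

Lemma bigvmin_le (I : eqType) (r : seq I) (F : I -> option G) i : i \in r ->
  vle (\big[@vmin G/None]_(j <- r) F j) (F i).
Proof.
elim: r => // j r IH; rewrite inE big_cons /vmin => /orP[/eqP->|/IH H].
  case: ifP => [_|wr]; first exact: vle_refl.
  by have := vle_total (F j) (\big[@vmin G/None]_(k <- r) F k); rewrite wr.
by case: ifP => // wr; apply: vle_trans wr H.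
Qed.

Lemma bigvmin_attained (I : eqType) (r : seq I) (F : I -> option G) : r != [::] ->
  exists2 i, i \in r & \big[@vmin G/None]_(j <- r) F j = F i.
Proof.
elim: r => // j r IH _; rewrite big_cons /vmin.
case: ifP => [_|jr]; first by exists j; rewrite ?mem_head.
have r0 : r != [::] by apply: contraFneq jr => ->; rewrite big_nil; case: (F j).
by have [i ir ->] := IH r0; exists i; rewrite // inE ir orbT.
Qed.

Lemma trop_le f u : vle (trop v f gamma) (trop_term v f gamma u).
Proof.
have [uf|/trop_term_out->//] := boolP (u \in msupp f).
exact: bigvmin_le.
Qed.

Lemma trop_attained f : f != 0 ->
  exists2 u, u \in msupp f & trop v f gamma = trop_term v f gamma u.
Proof.
move=> f0; have f0' : (msupp f : seq _) != [::].
  by apply: contraNneq f0 => sf; apply/eqP; rewrite [f]monalgE sf big_nil.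
exact: bigvmin_attained.
Qed.

Lemma trop_some f : f != 0 -> exists a, trop v f gamma = Some a.
Proof. by case/trop_attained => u uf ->; apply: trop_term_in. Qed.

(** If only one term attained the minimum, it would equal minus the sum of the others,
    all of larger valuation. *)
Lemma root_tropical_root f (z : (K ^ n)%type) :
    (forall i, v (z i) = Some (gamma i)) -> laurent_eval f z = 0 ->
  tropical_root v f gamma.
Proof.
move=> vz fz; have [->|f0] := eqVneq f 0; first by left.
right; have [u uf uE] := trop_attained f0.
apply: contrapT => nroot; pose m w := f@_w * \prod_(i < n) z i ^ w i.
have vm w : v (m w) = trop_term v f gamma w.
  rewrite valuationM /trop_term; congr vadd; apply: valuation_prod => i.
  exact: valuationXz.
have [a ua] := trop_some f0.
have strict w : w \in rem u (msupp f) -> vlt (Some a) (v (m w)).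
  rewrite mem_rem_uniq ?fset_uniq // inE => /andP[wu wf].
  rewrite vm -ua; apply: vle_neq_vlt; first exact: trop_le.
  by move=> wE; apply: nroot; exists u, w; split=> //; rewrite eq_sym.
have := vlt_valuation_sum strict; have := fz; rewrite /laurent_eval (big_rem u) //= => /eqP.
rewrite addrC addr_eq0 => /eqP->; rewrite valuationN vm -uE ua.
by rewrite /vlt vle_refl.
Qed.

End TropicalTheory.

Section InitialForms.
Variables (K : fieldType) (G : orderedZmodType) (v : valuation K G) (s : cross_section v).
Variables (n : nat) (gamma : (G ^ n)%type).
Implicit Types (f : {laurent K[n]}) (u w : (int ^ n)%type).

Local Notation k := (residue_field v).
Local Notation term f u := (trop_term v f gamma u).

(** The coefficient at u of f (s(gamma) x); its valuation is the tropical term of f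
    at u. *)
Definition twisted_coef f u : K := f@_u * s (pairing u gamma).

Lemma valuation_twisted f u : v (twisted_coef f u) = term f u.
Proof. by rewrite valuationM cross_sectionK. Qed.

Lemma mcoeff_initial_form f w : (initial_form s f gamma)@_w =
  if (w \in msupp f) && (term f w == trop v f gamma)
  then residue v (f@_w * s (- odflt 0 (v f@_w))) else 0.
Proof. by rewrite /initial_form mcoeff_sumU ?fset_uniq. Qed.

(** f (s(gamma) x) has integral coefficients, and g is its residue polynomial. *)
Definition reduces_to f (g : {laurent k[n]}) :=
  (forall u, twisted_coef f u \in val_ring v) /\
  forall u, g@_u = residue v (twisted_coef f u).

Lemma twisted_mulU u a f w :
  twisted_coef ((mkmalgU u (a * s (- pairing u gamma)) : {laurent K[n]}) * f) w =
  a * twisted_coef f (w - u).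
Proof.
rewrite /twisted_coef mcoeff_mulU.
have -> : pairing w gamma = pairing u gamma + pairing (w - u) gamma.
  by rewrite -pairingD addrC subrK.
rewrite cross_sectionD cross_sectionN; field.
exact: cross_section_neq0.
Qed.

(** Dividing f by an element of value trop(f)(gamma) makes f (s(gamma) x) integral and
    leaves exactly the terms attaining the minimum in the residue. *)
Lemma reduces_to_initial_form f : f != 0 -> exists c : K,
  reduces_to ((mkmalgU 0 c : {laurent K[n]}) * f) (initial_form s f gamma).
Proof.
move=> f0; have [m mE] := trop_some v gamma f0; exists (s (- m)).
have tw u : twisted_coef ((mkmalgU 0 (s (- m)) : {laurent K[n]}) * f) u = s (- m) * twisted_coef f u.
  have := twisted_mulU 0 (s (- m)) f u.
  by rewrite pairing0 oppr0 cross_section0 mulr1 subr0.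
have vtw u : v (s (- m) * twisted_coef f u) = vadd (term f u) (Some (- m)).
  by rewrite valuationM cross_sectionK valuation_twisted vaddC.
have tm : Some 0 = vadd (trop v f gamma) (Some (- m)) by rewrite mE /= subrr.
have twV u : s (- m) * twisted_coef f u \in val_ring v.
  by rewrite inE vtw tm vle_add2r trop_le.
split=> u; rewrite tw // mcoeff_initial_form.
case: ifPn => [/andP[uf /eqP uE]|nu].
  congr (residue v _); rewrite /twisted_coef mulrCA; congr (_ * _).
  move: uE; rewrite mE /trop_term; case: (v f@_u) => //= a [<-].
  by rewrite -cross_sectionD opprD addrNK.
apply/esym/eqP; rewrite residue_eq0 // vtw tm vlt_add2r.
have [uf|uf] := boolP (u \in msupp f); last by rewrite trop_term_out // mE.
rewrite uf /= in nu; apply: vle_neq_vlt; first exact: trop_le.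
by move/esym/eqP; apply/negP.
Qed.

Variable I : {laurent K[n]} -> Prop.
Hypothesis Iid : is_ideal I.

Definition reductions (g : {laurent k[n]}) : Prop := exists2 f, I f & reduces_to f g.

(** Stability under multiplication holds because monomials over the residue field lift. *)
Lemma reductions_ideal : is_ideal reductions.
Proof.
have H0 : reductions 0.
  exists 0; first by case: Iid.
  have t0 u : twisted_coef 0 u = 0 by rewrite /twisted_coef mcoeff0 mul0r.
  by split=> u; rewrite t0 ?rpred0 // residue0 mcoeff0.
have HD g h : reductions g -> reductions h -> reductions (g + h).
  move=> [a Ia [aV aE]] [b Ib [bV bE]]; exists (a + b); first by case: Iid => _ D _; apply: D.
  have tD u : twisted_coef (a + b) u = twisted_coef a u + twisted_coef b u.
    by rewrite /twisted_coef mcoeffD mulrDl.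
  split=> u; rewrite tD; first by rewrite rpredD.
  by rewrite mcoeffD aE bE residueD.
split=> // a g [f If [fV fE]]; rewrite [a]monalgE mulr_suml.
elim/big_ind: _ => // u _.
have [c cV cE] := residue_surj a@_u.
exists ((mkmalgU u (c * s (- pairing u gamma)) : {laurent K[n]}) * f).
  by case: Iid => _ _ M; apply: M.
split=> w; rewrite twisted_mulU; first by rewrite rpredM.
by rewrite mcoeff_mulU residueM // cE fE.
Qed.

(** If the initial ideal contained 1, then some f in I would reduce to 1, and its
    only term of minimal value would be the one at 0. *)
Lemma tropical_roots_initial_ideal_proper :
  (forall f, I f -> tropical_root v f gamma) -> is_proper (initial_ideal s I gamma).
Proof.
move=> trop_root all1.
have [f If [fV f1]] : reductions 1.
  apply: (all1 1 reductions); first exact: reductions_ideal.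
  move=> _ [f If ->]; have [->|f0] := eqVneq f 0.
    have -> : initial_form s 0 gamma = 0 by apply/malgP => u; rewrite mcoeff_initial_form msupp0 inE !mcoeff0.
    by case: reductions_ideal.
  have [c cf] := reduces_to_initial_form f0; exists ((mkmalgU 0 c : {laurent K[n]}) * f) => //.
  by case: Iid => _ _ M; apply: M.
have c1 u : (1 : {laurent k[n]})@_u = if u == 0 then 1 else 0.
  by rewrite -[1]/(mkmalgU 0 1) mcoeffU eq_sym; case: eqP; rewrite ?mulr1n ?mulr0n.
have f0 : term f 0 = Some 0.
  have := f1 0; rewrite c1 eqxx => /eqP; rewrite eq_sym => /eqP r1.
  have : residue v (twisted_coef f 0) != 0 by rewrite r1 oner_eq0.
  rewrite residue_eq0 // /vlt negbK valuation_twisted => le0.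
  by apply: vle_anti => //; have := fV 0; rewrite inE valuation_twisted.
have fpos u : u != 0 -> vlt (Some 0) (term f u).
  move=> u0; rewrite -valuation_twisted -residue_eq0 // -f1 c1 (negPf u0) //.
have [f00|[u [w [uf wf uw uE wE]]]] := trop_root f If.
  by move: f0; rewrite f00 /trop_term mcoeff0 valuation0.
have le0 : vle (trop v f gamma) (Some 0) by rewrite -f0 trop_le.
have [u0|u0] := eqVneq u 0.
  have := fpos w; rewrite eq_sym -u0 => /(_ uw); rewrite wE.
  by rewrite /vlt le0.
by have := fpos u u0; rewrite uE /vlt le0.
Qed.

(** The initial form of 1 + g is a nonzero constant. *)
Lemma initial_ideal_proper_avoids g : is_proper (initial_ideal s I gamma) ->
  (forall u, vlt (Some 0) (term g u)) -> ~ I (1 + g).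
Proof.
move=> proper gpos If; apply: proper => a; set f := 1 + g in If.
have fE u : f@_u = (u == 0)%:R + g@_u.
  rewrite mcoeffD -[1 in LHS]/(mkmalgU 0 1) mcoeffU eq_sym.
  by case: eqP; rewrite ?mulr1n ?mulr0n.
have g0 : vlt (Some 0) (v g@_0) by have := gpos 0; rewrite /trop_term pairing0 vadd0.
have vf0 : v f@_0 = Some 0.
  rewrite fE eqxx; apply: vle_anti.
    apply/negPn/negP => f0pos; have := @vlt_valuationD _ _ v _ (- g@_0) _ f0pos.
    by rewrite valuationN addrK valuation1 => /(_ g0); rewrite /vlt vle_refl.
  apply: vle_trans (valuationD v 1 g@_0); rewrite valuation1.
  by apply: vle_vmin; [apply: vle_refl|apply: vlt_vle].
have f0 : term f 0 = Some 0 by rewrite /trop_term vf0 pairing0 vadd0.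
have fu u : u != 0 -> vlt (Some 0) (term f u).
  by move=> /negPf u0; rewrite /trop_term fE u0 add0r; apply: gpos.
have fn0 : f != 0.
  by apply/eqP => f00; move: vf0; rewrite f00 mcoeff0 valuation0.
have tf : trop v f gamma = Some 0.
  have [u uf uE] := trop_attained v gamma fn0; have := trop_le v gamma f 0.
  rewrite f0 uE; have [->|/fu u0] := eqVneq u 0; first by rewrite f0.
  by move=> le0; move: u0; rewrite /vlt le0.
set c := residue v (f@_0 * s (- odflt 0 (v f@_0))).
have c0 : c != 0.
  rewrite /c vf0 /= oppr0 cross_section0 mulr1 residue_eq0; first by rewrite vf0 /vlt vle_refl.
  by rewrite inE vf0 /= lexx.
have inE' : initial_form s f gamma = mkmalgU 0 c.
  apply/malgP => u; rewrite mcoeff_initial_form tf mcoeffU eq_sym.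
  have [->|u0] := eqVneq u 0.
    by rewrite f0 eqxx andbT -mcoeff_neq0 mulr1n ifT //; apply/eqP => E; move: vf0; rewrite E valuation0.
  rewrite mulr0n ifF //; apply/negbTE; rewrite negb_and; apply/orP; right.
  by apply/eqP => E; have := fu u u0; rewrite E /vlt vle_refl.
move=> H Hid Hin; have -> : a = (a * (mkmalgU 0 c^-1 : {laurent k[n]})) * initial_form s f gamma.
  by rewrite inE' -mulrA laurentUM addr0 mulVf // mulr1.
by case: Hid => _ _ M; apply: M; apply: Hin; exists f.
Qed.

End InitialForms.

(** * Zeros of prescribed valuation *)

Section TropicalNullstellensatz.
Variables (K : closedFieldType) (G : orderedZmodType) (v : valuation K G) (s : cross_section v).
Variables (n : nat) (gamma : (G ^ n)%type).

Local Notation J := ('I_n * bool)%type.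

(** Monomials scaled to have tropical value 0 at gamma. *)
Definition unit_monomial (u : (int ^ n)%type) : {laurent K[n]} :=
  mkmalgU u (s (- pairing u gamma)).

Lemma unit_monomialD u w : unit_monomial (u + w) = unit_monomial u * unit_monomial w.
Proof. by rewrite laurentUM -cross_sectionD -opprD -pairingD. Qed.

Lemma unit_monomial0 : unit_monomial 0 = 1.
Proof. by rewrite /unit_monomial pairing0 oppr0 cross_section0. Qed.

Definition coordinate (j : J) := unit_monomial (unit_exp j).

Lemma prod_coordinate (e : J -> nat) :
  \prod_j coordinate j ^+ e j = unit_monomial (\sum_j unit_exp j *+ e j).
Proof.
rewrite (big_morph unit_monomial unit_monomialD unit_monomial0).
apply: eq_bigr => j _; elim: (e j) => [|k IH]; first by rewrite expr0 mulr0n unit_monomial0.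
by rewrite exprS mulrS unit_monomialD IH.
Qed.

Lemma laurent_meval f :
  f = meval (@laurentC n K) coordinate [seq (f@_u * s (pairing u gamma), split_exp u) | u <- msupp f].
Proof.
rewrite [LHS]monalgE /meval big_map; apply: eq_bigr => u _ /=.
rewrite prod_coordinate split_expE laurentUM add0r cross_sectionN mulfK //.
exact: cross_section_neq0.
Qed.

Lemma infinitesimal_trop_term mu u : infinitesimal (val_ring v : subringClosed K) mu ->
  vlt (Some 0) (trop_term v (meval (@laurentC n K) coordinate mu) gamma u).
Proof.
move=> muN; rewrite /trop_term /meval mcoeff_sum.
have -> : Some 0 = vadd (Some (- pairing u gamma)) (Some (pairing u gamma)) :> option G.
  by rewrite /= addNr.
rewrite vlt_add2r; elim: mu muN => [|p mu IH] /=.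
  by rewrite big_nil valuation0.
case/andP=> pN /IH muN; rewrite big_cons; apply: vlt_valuationD => //.
rewrite prod_coordinate laurentUM add0r mcoeffU; case: eqP => [->|_]; last first.
  by rewrite mulr0n valuation0.
rewrite mulr1n valuationM cross_sectionK.
by move: pN; rewrite nonunitE -(vlt_add2r (- pairing u gamma)) /= add0r.
Qed.

(** The Nullstellensatz applies to the scaled variables and their inverses; the
    relations between them make the coordinates of the zero units. *)
Lemma initial_ideal_proper_zero (I : {laurent K[n]} -> Prop) :
    is_ideal I -> is_proper (initial_ideal s I gamma) ->
  exists z : (K ^ n)%type,
    [/\ forall i : 'I_n, z i != 0,
        forall f : {laurent K[n]}, I f -> laurent_eval f z = 0
      & forall i : 'I_n, v (z i) = Some (gamma i)].
Proof.
move=> Iid proper.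
have [||y [yV yI]] := @valuative_nullstellensatz K (val_ring v) J
    (@valuation_val_subring _ _ v) _ (@laurentC n K) coordinate I _ Iid.
- by move=> f; eexists; apply: laurent_meval.
- move=> mu muN; exact: (initial_ideal_proper_avoids proper (fun u => infinitesimal_trop_term u muN)).
have yy i : y (i, true) * y (i, false) = 1.
  pose r := meval_mul (meval_var K (i, true)) (meval_var K (i, false)) ++ meval_const J (-1).
  have rE (S : comNzRingType) (h : {rmorphism K -> S}) (x : J -> S) :
      meval h x r = x (i, true) * x (i, false) - 1.
    by rewrite meval_cat meval_mulE !meval_varE meval_constE rmorphN1.
  apply/eqP; rewrite -subr_eq0 -(rE K idfun) yI // rE -unit_monomialD.
  have -> : unit_exp (i, true) + unit_exp (i, false) = 0.
    by apply/ffunP => j; rewrite !ffunE /=; case: eqP => // _; rewrite ?subrr ?addr0.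
  by rewrite unit_monomial0 subrr; case: Iid.
have vy i : v (y (i, true)) = Some 0.
  have := yV (i, true); have := yV (i, false); have := congr1 v (yy i).
  rewrite !inE valuationM valuation1.
  case: (v (y (i, true))) (v (y (i, false))) => [a|] [b|] //= [ab] b0 a0.
  congr Some; apply/le_anti; rewrite a0 andbT.
  by have := ozmod_lerD2l _ _ a b0; rewrite ab addr0.
exists [ffun i => y (i, true) * s (gamma i)]; split=> [i|f If|i].
- rewrite ffunE mulf_neq0 ?cross_section_neq0 //.
  by apply/eqP => y0; move/eqP: (yy i); rewrite y0 mul0r eq_sym oner_eq0.
- have := yI [seq (f@_u * s (pairing u gamma), split_exp u) | u <- msupp f].
  rewrite -laurent_meval => /(_ If) <-; rewrite /meval big_map; apply: eq_bigr => u _ /=.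
  rewrite -mulrA prod_split_exp // cross_section_sum -big_split; congr (_ * _).
  by apply: eq_bigr => i _; rewrite ffunE expfzMl -cross_sectionMz mulrC.
- by rewrite ffunE valuationM vy cross_sectionK /= add0r.
Qed.

End TropicalNullstellensatz.

Theorem theorem1p12 (K : closedFieldType) (G : orderedZmodType)
    (v : valuation K G) (s : cross_section v) (n : nat)
    (I : {laurent K[n]} -> Prop) (hI : is_ideal I) (gamma : (G ^ n)%type) :
  [<-> forall f : {laurent K[n]}, I f -> tropical_root v f gamma;
       is_proper (initial_ideal s I gamma);
       exists z : (K ^ n)%type,
         [/\ forall i : 'I_n, z i != 0,
             forall f : {laurent K[n]}, I f -> laurent_eval f z = 0
           & forall i : 'I_n, v (z i) = Some (gamma i)]].
Proof.
tfae.
- exact: tropical_roots_initial_ideal_proper.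
- exact: initial_ideal_proper_zero.
- by move=> [z [z0 zI vz]] f If; apply: root_tropical_root vz (zI f If).
Qed.
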